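(* Let $G$ be a finitely generated group, and let $\mathcal{C}(G)\subset\mathrm{Hom}(G,\mathrm{PGL}(n+1,\mathbb{R}))$ be the subset of all $\rho$ such that there exists a properly convex $\Omega\subset\mathbb{RP}^n$ with $\dim\Omega=n$ that is preserved by $\rho(G)$. Then $\chi(\mathcal{C}(G))$ is a closed subset of the character variety $\mathcal{X}(G)$.
   Context: A subset $\Omega\subset\mathbb{RP}^n$ is convex if every pair of points in $\Omega$ is contained in a segment of a projective line that lies in $\Omega$. It is properly convex if in addition it is (non-empty and) open and its closure contains no projective line. No discreteness or faithfulness of $\rho$ is assumed. The character variety is $\mathcal{X}(G)=\mathrm{Hom}(G,\mathrm{PGL}(n+1,\mathbb{R}))/\!/\mathrm{PGL}(n+1,\mathbb{R})$, the (real) geometric invariant theory quotient of $\mathrm{Hom}(G,\mathrm{PGL}(n+1,\mathbb{R}))$ by the conjugation action, and $\chi:\mathrm{Hom}(G,\mathrm{PGL}(n+1,\mathbb{R}))\to\mathcal{X}(G)$ is the projection. Concretely, $\mathrm{Hom}(G,\mathrm{PGL}(n+1,\mathbb{R}))$ has the topology of pointwise convergence, $\chi(\rho)=\chi(\rho')$ if and only if the closures of the conjugation orbits of $\rho$ and $\rho'$ intersect, and $\mathcal{X}(G)$ has the quotient topology (which is Hausdorff). *)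

(* Defs.v *)
From HB Require Import structures.
From mathcomp Require Import all_boot all_order all_algebra.
From mathcomp Require Import all_classical all_reals all_analysis.
From Stdlib Require Import Relation_Operators Operators_Properties.

Set Implicit Arguments.
Unset Strict Implicit.
Unset Printing Implicit Defensive.

Import Order.TTheory GRing.Theory Num.Theory.
Import numFieldNormedType.Exports.

Local Open Scope classical_set_scope.
Local Open Scope ring_scope.
Local Open Scope quotient_scope.

Definition finitely_generated (G : groupType) : Prop :=
  exists S : seq G, forall H : {pred G},
    group_closed H -> {subset S <= H} -> forall g, g \in H.

Section ProportionalityClasses.
Variables (R : realType) (V : lmodType R) (A : set V).

Definition proportional (u v : A) : bool :=
  `[< exists2 c : R, c != 0 & val u = c *: val v >].

Lemma proportional_refl : reflexive proportional.
Proof.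
by move=> u; apply/asboolP; exists 1; rewrite ?oner_eq0// scale1r.
Qed.

Lemma proportional_sym : symmetric proportional.
Proof.
suff sub u v : proportional u v -> proportional v u.
  by move=> u v; apply/idP/idP; exact: sub.
move=> /asboolP[c c0 uv]; apply/asboolP; exists c^-1; first by rewrite invr_eq0.
by rewrite uv scalerA mulVf// scale1r.
Qed.

Lemma proportional_trans : transitive proportional.
Proof.
move=> v u w /asboolP[c c0 uv] /asboolP[d d0 vw]; apply/asboolP.
by exists (c * d); rewrite ?mulf_neq0// uv vw scalerA.
Qed.

Canonical proportional_equiv :=
  EquivRel proportional proportional_refl proportional_sym proportional_trans.

End ProportionalityClasses.

(** * The projective space RP^n *)

Definition nzvec (R : realType) (n : nat) : set 'cV[R]_n.+1 :=
  [set v | v != 0].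
Arguments nzvec : clear implicits.

(* The subset topology on the nonzero vectors, then the quotient topology. *)
Definition RP (R : realType) (n : nat) : Type :=
  quotient_topology {eq_quot (@proportional R _ (nzvec R n))}.

HB.instance Definition _ R n := Quotient.copy (RP R n)
  (quotient_topology {eq_quot (@proportional R _ (nzvec R n))}).
HB.instance Definition _ R n := Topological.copy (RP R n)
  (quotient_topology {eq_quot (@proportional R _ (nzvec R n))}).

(** * The topological group PGL(n+1, R) *)

Definition GL (R : realType) (n : nat) : set 'M[R]_n.+1 :=
  [set A | A \in unitmx].
Arguments GL : clear implicits.

Definition PGL (R : realType) (n : nat) : Type :=
  quotient_topology {eq_quot (@proportional R _ (GL R n))}.

HB.instance Definition _ R n := Quotient.copy (PGL R n)
  (quotient_topology {eq_quot (@proportional R _ (GL R n))}).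
HB.instance Definition _ R n := Topological.copy (PGL R n)
  (quotient_topology {eq_quot (@proportional R _ (GL R n))}).

Section PGLGroup.
Variables (R : realType) (n : nat).
Implicit Types (A B : GL R n) (p q : PGL R n).

Lemma GL_unit A : val A \in unitmx.
Proof. exact: set_valP A. Qed.

Definition GLmul A B : GL R n :=
  exist _ (val A *m val B)
    (mem_set (etrans (unitmx_mul _ _)
       (introT andP (conj (GL_unit A) (GL_unit B))))).

Definition GLinv A : GL R n :=
  exist _ (invmx (val A)) (mem_set (etrans (unitmx_inv _) (GL_unit A))).

Definition GLone : GL R n := exist _ 1%:M (mem_set (unitmx1 _ _)).

Lemma PGL_eqP A B :
  (\pi_(PGL R n) A = \pi_(PGL R n) B) <->
  (exists2 c : R, c != 0 & val A = c *: val B).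
Proof.
split=> [/eqmodP/asboolP//|h].
by apply/eqmodP/asboolP.
Qed.

Lemma PGL_reprP A :
  exists2 c : R, c != 0 & val (repr (\pi_(PGL R n) A)) = c *: val A.
Proof. by apply/PGL_eqP; rewrite reprK. Qed.

Definition PGLmul p q : PGL R n := \pi_(PGL R n) (GLmul (repr p) (repr q)).
Definition PGLinv p : PGL R n := \pi_(PGL R n) (GLinv (repr p)).
Definition PGLone : PGL R n := \pi_(PGL R n) GLone.

Lemma PGLmulE A B :
  PGLmul (\pi_(PGL R n) A) (\pi_(PGL R n) B) = \pi_(PGL R n) (GLmul A B).
Proof.
apply/PGL_eqP => /=; have [c c0 ->] := PGL_reprP A; have [d d0 ->] := PGL_reprP B.
by exists (c * d); rewrite ?mulf_neq0// -scalemxAl -scalemxAr scalerA.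
Qed.

Lemma PGLinvE A : PGLinv (\pi_(PGL R n) A) = \pi_(PGL R n) (GLinv A).
Proof.
apply/PGL_eqP => /=; have [c c0 ->] := PGL_reprP A.
exists c^-1; first by rewrite invr_eq0.
by rewrite invmxZ// unitmxZ ?unitfE// GL_unit.
Qed.

Lemma PGLmulA : associative PGLmul.
Proof.
elim/quotW=> A; elim/quotW=> B; elim/quotW=> C.
rewrite (PGLmulE B C) (PGLmulE A B) !PGLmulE.
by apply: congr1; apply: val_inj; rewrite /= mulmxA.
Qed.

Lemma PGLmul1g : left_id PGLone PGLmul.
Proof.
elim/quotW=> A; rewrite /PGLone PGLmulE.
by apply: congr1; apply: val_inj; rewrite /= mul1mx.
Qed.

Lemma PGLmulg1 : right_id PGLone PGLmul.
Proof.
elim/quotW=> A; rewrite /PGLone PGLmulE.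
by apply: congr1; apply: val_inj; rewrite /= mulmx1.
Qed.

Lemma PGLmulVg : left_inverse PGLone PGLinv PGLmul.
Proof.
elim/quotW=> A; rewrite PGLinvE PGLmulE.
apply: congr1; apply: val_inj.
by rewrite /= mulVmx// GL_unit.
Qed.

Lemma PGLmulgV : right_inverse PGLone PGLinv PGLmul.
Proof.
elim/quotW=> A; rewrite PGLinvE PGLmulE.
apply: congr1; apply: val_inj.
by rewrite /= mulmxV// GL_unit.
Qed.

End PGLGroup.

HB.instance Definition _ R n := isGroup.Build (PGL R n)
  (@PGLmulA R n) (@PGLmul1g R n) (@PGLmulg1 R n) (@PGLmulVg R n)
  (@PGLmulgV R n).

(** * The action of PGL(n+1, R) on RP^n *)

Section Action.
Variables (R : realType) (n : nat).

Lemma GLact_subproof (A : GL R n) (v : nzvec R n) :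
  val A *m val v \in nzvec R n.
Proof.
apply/mem_set => /=; apply: contraNneq (set_valP v) => Av0.
by rewrite -(mulKmx (GL_unit A) (val v)) Av0 mulmx0.
Qed.

Definition GLact (A : GL R n) (v : nzvec R n) : nzvec R n :=
  exist _ (val A *m val v) (GLact_subproof A v).

Definition pact (p : PGL R n) (x : RP R n) : RP R n :=
  \pi_(RP R n) (GLact (repr p) (repr x)).

Lemma RP_eqP (u v : nzvec R n) :
  (\pi_(RP R n) u = \pi_(RP R n) v) <->
  (exists2 c : R, c != 0 & val u = c *: val v).
Proof.
split=> [/eqmodP/asboolP//|h].
by apply/eqmodP/asboolP.
Qed.

Lemma pactE (A : GL R n) (v : nzvec R n) :
  pact (\pi_(PGL R n) A) (\pi_(RP R n) v) = \pi_(RP R n) (GLact A v).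
Proof.
apply/RP_eqP => /=; have [c c0 ->] := PGL_reprP A.
have [d d0 ->] : exists2 d, d != 0 & val (repr (\pi_(RP R n) v)) = d *: val v.
  by apply/RP_eqP; rewrite reprK.
by exists (c * d); rewrite ?mulf_neq0// -scalemxAl -scalemxAr scalerA.
Qed.

End Action.

(** * Properly convex subsets of RP^n *)

Section Convexity.
Variables (R : realType) (n : nat).
Implicit Types (S : set 'cV[R]_n.+1) (W : {vspace 'cV[R]_n.+1}).
Implicit Types (Omega : set (RP R n)).

Definition projectivization S : set (RP R n) :=
  [set \pi_(RP R n) v | v in [set v : nzvec R n | S (val v)]].

Definition proj_subspace W : set (RP R n) := projectivization [set` W].

Definition proj_line (L : set (RP R n)) : Prop :=
  exists2 W, \dim W = 2%N & L = proj_subspace W.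

(* For independent [a] and [b], one of the two closed arcs with end points
   [a] and [b] of the line through them (replacing [b] by [- b] gives the other
   one); otherwise this is a point, or empty if [a = b = 0]. *)
Definition segment (a b : 'cV[R]_n.+1) : set (RP R n) :=
  projectivization
    [set v | exists s t : R, [/\ 0 <= s, 0 <= t & v = s *: a + t *: b]].

Definition proj_convex Omega : Prop :=
  forall x y, Omega x -> Omega y ->
    exists a b, [/\ segment a b x, segment a b y & segment a b `<=` Omega].

Definition properly_convex Omega : Prop :=
  [/\ proj_convex Omega, Omega !=set0, open Omega &
      forall L, proj_line L -> ~ (L `<=` closure Omega)].

(* The dimension of [Omega] is that of the smallest projective subspace which
   contains it. *)
Definition has_proj_dim Omega (d : nat) : Prop :=
  exists W, [/\ \dim W = d.+1, Omega `<=` proj_subspace W &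
    forall W', Omega `<=` proj_subspace W' -> (W <= W')%VS].

End Convexity.

(** * Representations and the character variety *)

Section CharacterVariety.
Variables (R : realType) (n : nat) (G : groupType).

(* The subset topology from [{ptws G -> PGL R n}] is the topology of pointwise
   convergence. *)
Definition HomPGL : set {ptws G -> PGL R n} :=
  [set f | {morph f : g h / (g * h)%g >-> (g * h)%g}].

Implicit Types rho sigma : HomPGL.

Definition rep_fun rho : G -> PGL R n := val rho.

Definition conj_orbit rho : set HomPGL :=
  [set sigma | exists p : PGL R n,
     forall g, rep_fun sigma g = (p * rep_fun rho g * p^-1)%g].

Definition orbit_closures_meet rho sigma : Prop :=
  closure (conj_orbit rho) `&` closure (conj_orbit sigma) !=set0.

(* [orbit_closures_meet] is in fact transitive: the closure of each orbit
   contains exactly one closed orbit (Luna, Richardson-Slodowy). The equivalence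
   relation that it generates is taken so that the quotient can be formed
   without appealing to that theorem. *)
Definition chi_equiv rho sigma : bool :=
  `[< clos_refl_sym_trans HomPGL orbit_closures_meet rho sigma >].

Lemma chi_equiv_refl : reflexive chi_equiv.
Proof. by move=> rho; apply/asboolP; exact: rst_refl. Qed.

Lemma chi_equiv_sym : symmetric chi_equiv.
Proof.
by move=> rho sigma; apply/asboolP/asboolP => h; exact: rst_sym.
Qed.

Lemma chi_equiv_trans : transitive chi_equiv.
Proof.
move=> sigma rho tau /asboolP h /asboolP k; apply/asboolP.
exact: rst_trans h k.
Qed.

Canonical chi_equiv_equiv :=
  EquivRel chi_equiv chi_equiv_refl chi_equiv_sym chi_equiv_trans.

Definition character_variety : Type := quotient_topology {eq_quot chi_equiv}.

HB.instance Definition _ := Quotient.copy character_variety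
  (quotient_topology {eq_quot chi_equiv}).
HB.instance Definition _ := Topological.copy character_variety
  (quotient_topology {eq_quot chi_equiv}).

Definition chi (rho : HomPGL) : character_variety := \pi_character_variety rho.

Definition preserves_properly_convex : set HomPGL :=
  [set rho | exists Omega : set (RP R n),
     [/\ properly_convex Omega, has_proj_dim Omega n &
         forall g, pact (rep_fun rho g) @` Omega = Omega]].

End CharacterVariety.

Arguments HomPGL : clear implicits.
Arguments character_variety : clear implicits.
Arguments preserves_properly_convex : clear implicits.

(* Main.v *)
Require Import Defs.
From mathcomp Require Import all_boot all_order all_algebra.
From mathcomp Require Import all_classical all_reals all_analysis.
From mathcomp Require Import lra.
From Stdlib Require Import Relation_Operators.

(* A representation in C(G) has a lift to matrices of determinant 1 or -1 which preserves
   an open convex cone. Every combination, with nonnegative coefficients, of products of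
   these matrices preserves the cone, hence has the Perron-Frobenius property: its
   spectral radius is an eigenvalue. This property depends only on characteristic
   polynomials, so the representations having a lift with this property form a closed set
   which is a union of classes for the equivalence defining X(G).

   Conversely, let rho have such a lift. After degenerating rho inside its class, the
   trace form on the algebra spanned by the lift is nondegenerate. The closure K of the
   set of combinations above is then a sharp cone in this algebra: otherwise K contains
   -e for some nonzero idempotent e, against the Perron-Frobenius property. Elements of
   minimal rank in K yield idempotents P with P K P contained in R P, and from these a
   vector v with X v <> 0 for every nonzero X in K. By compactness the cone spanned by
   the orbit under K of a small ball around v is still sharp, and its interior
   projects onto a properly convex domain preserved by rho. *)

Set Implicit Arguments.
Unset Strict Implicit.
Unset Printing Implicit Defensive.

Import Order.TTheory GRing.Theory Num.Theory Num.Def.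
Import numFieldNormedType.Exports.

Local Open Scope classical_set_scope.
Local Open Scope ring_scope.
Local Open Scope quotient_scope.

(** * Matrices: convergence and compactness *)

Section MatrixTopology.
Variable R : realType.

(** Limits of invariant domains cannot be used directly, because [preserves_properly_convex] is
    neither closed nor a union of classes. For [n = 1] the unipotent matrix with rows (1, 1) and (0,
    1) preserves no properly convex set: its only invariant interval is the complement of a point.
    Yet it is a limit of hyperbolic elements, which preserve one, and the closure of its conjugation
    orbit contains the identity, which does too. Hence the detour through a condition on
    characteristic polynomials, and the need to change the representative of a class before a domain
    can be built. PGL gives matrices only up to scale; determinant 1 or -1 still leaves one sign for
    each group element, and these signs admit no canonical choice. Limits are therefore taken along
    ultrafilters, where a choice of sign is eventually constant and bounded matrices converge. *)

Lemma cvg_mxP T (F : set_system T) {FF : Filter F} m n (f : T -> 'M[R]_(m, n))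
  (M : 'M[R]_(m, n)) :
  f @ F --> M <-> forall i j, (fun t => f t i j) @ F --> M i j.
Proof.
split=> [fM i j|fM].
  by apply: (@cvg_comp _ _ _ f (fun N : 'M[R]_(m, n) => N i j) F (nbhs M)) => //;
    exact: coord_continuous.
move=> A [B BM BA]; rewrite /= nbhs_simpl /=.
have : \forall t \near F, forall i j, B i j (f t i j).
  by apply: filter_forall => i; apply: filter_forall => j; exact: fM.
by apply: filterS => t Bt; exact: BA.
Qed.

Lemma cvg_mulmx T (F : set_system T) {FF : Filter F} m n p
    (f : T -> 'M[R]_(m, n)) (g : T -> 'M[R]_(n, p)) (M : 'M[R]_(m, n))
      (N : 'M[R]_(n, p)) :
  f @ F --> M -> g @ F --> N -> (fun t => f t *m g t) @ F --> M *m N.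
Proof.
move=> /cvg_mxP fM /cvg_mxP gN; apply/cvg_mxP => i j.
under eq_fun do rewrite mxE; rewrite mxE.
by apply: (@cvg_big _ _ +%R 0 _ (@add_continuous R^o)) => k _; apply: cvgM.
Qed.

Lemma mulmx_continuous m n p (M : 'M[R]_(m, n)) :
  continuous (fun N : 'M[R]_(n, p) => M *m N).
Proof. by move=> N; apply: (@cvg_mulmx _ (nbhs N) _ _ _ _ (fun=> M) id);
  [exact: cvg_cst|exact: cvg_id]. Qed.

Lemma cvg_trace T (F : set_system T) {FF : Filter F} n (f : T -> 'M[R]_n)
    (M : 'M[R]_n) :
  f @ F --> M -> (fun t => \tr (f t)) @ F --> \tr M.
Proof. by move=> /cvg_mxP fM; apply: (@cvg_big _ _ +%R 0 _ (@add_continuous R^o)) =>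
  i _; exact: fM. Qed.

Lemma cvg_det T (F : set_system T) {FF : Filter F} n (f : T -> 'M[R]_n) (M : 'M[R]_n) :
  f @ F --> M -> (fun t => \det (f t)) @ F --> \det M.
Proof.
move=> /cvg_mxP fM; apply: (@cvg_big _ _ +%R 0 _ (@add_continuous R^o)) => s _;
  apply: cvgM; first exact: cvg_cst.
elim: (index_enum _) => [|i r IHr].
  by under eq_fun do rewrite big_nil; rewrite big_nil; exact: cvg_cst.
under eq_fun do rewrite big_cons; rewrite big_cons.
by apply: cvgM.
Qed.

Lemma det_continuous n : continuous (fun M : 'M[R]_n => \det M).
Proof. by move=> M; apply: (@cvg_det _ (nbhs M) _ _ id); exact: cvg_id. Qed.

Lemma mx_closed1 m n (M : 'M[R]_(m, n)) : closed [set M].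
Proof.
by apply: accessible_closed_set1; apply: hausdorff_accessible; exact: norm_hausdorff.
Qed.

Lemma entry_le_norm m n (M : 'M[R]_(m, n)) i j : `|M i j| <= `|M|.
Proof.
rewrite [leRHS]/normr /= mx_normrE; apply/bigmax_geP; right => /=.
by exists (i, j).
Qed.

(** Ultrafilters replace subsequences: the image of an ultrafilter is again one, and each entry
    eventually stays in a compact interval. *)
Lemma ultra_bounded T (F : set_system T) (FU : UltraFilter F) m n
    (f : T -> 'M[R]_(m, n)) (b : R) :
  (\forall t \near F, `|f t| <= b) -> exists M : 'M[R]_(m, n), f @ F --> M.
Proof.
move=> fb.
have fij i j : exists x : R, (fun t => f t i j) @ F --> x.
  have := @segment_compact R (- b) b; rewrite compact_ultra.
  have GU : UltraFilter ((fun t => f t i j) @ F).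
    split => [|H HF GH]; first exact: fmap_proper_filter.
    apply/seteqP; split=> // A HA; rewrite /= nbhs_simpl/=.
    have [//|FA] := in_ultra_setVsetC ((fun t => f t i j) @^-1` A) FU.
    have HnA : H (~` A) by apply: GH.
    have : H (A `&` ~` A) by apply: filterI.
    by rewrite setICr => /filter_not_empty.
  case/(_ _ GU) => [|x []]; last by exists x.
  apply: filterS fb => t tb /=.
  by rewrite in_itv/= -ler_norml (le_trans (entry_le_norm _ _ _)).
exists (\matrix_(i, j) projT1 (cid (fij i j))); apply/cvg_mxP => i j.
by rewrite mxE; case: cid.
Qed.

Lemma ultra_bounded_real T (F : set_system T) (FU : UltraFilter F)
    (f : T -> R) (b : R) :
  (\forall t \near F, `|f t| <= b) -> exists x : R, f @ F --> x.
Proof.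
move=> fb.
have [|M fM] := @ultra_bounded T F FU 1 1 (fun t => (f t)%:M) b.
  apply: filterS fb => t tb; rewrite [leLHS]/normr/= mx_normrE.
  apply: bigmax_le => [|[i j] _]; first exact: le_trans tb.
  by rewrite !ord1 mxE eqxx mulr1n.
exists (M 0 0); move/cvg_mxP: fM => /(_ 0 0).
by under eq_fun do rewrite mxE eqxx mulr1n.
Qed.

Lemma mx_compact m n (A : set 'M[R]_(m, n)) b :
  closed A -> (forall M, A M -> `|M| <= b) -> compact A.
Proof.
move=> Acl Ab; rewrite compact_ultra => F FU FA.
have [|M FM] := @ultra_bounded _ F FU m n id b; first exact: filterS FA.
exists M; split=> //; exact: (closed_cvg _ Acl FA).
Qed.

(** A filter witnessing adherence is refined to an ultrafilter, so that bounded auxiliary data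
    chosen pointwise converge as well. *)
Lemma closed_ultra (T : topologicalType) (A : set T) :
  (forall F (p : T), UltraFilter F -> F --> p -> F A -> A p) -> closed A.
Proof.
move=> AP p; rewrite closureEcvg => -[G GF [Gp AG]].
have [H [HU GH]] := ultraFilterLemma GF.
apply: (AP H) => //; first by apply: cvg_trans Gp.
by apply: GH; apply: AG.
Qed.

Lemma closure_subset_closed (T : topologicalType) (A B : set T) :
  closed B -> A `<=` B -> closure A `<=` B.
Proof. by move=> Bcl AB; rewrite closureE; apply: bigcap_inf. Qed.

Lemma linear_mx_continuous m n p q (f : {linear 'M[R]_(m, n) -> 'M[R]_(p, q)}) :
  continuous f.
Proof.
have -> : (f : _ -> _) = fun X => \sum_i \sum_j X i j *: f (delta_mx i j).
  apply/funext => X; rewrite {1}[X]matrix_sum_delta linear_sum; apply: eq_bigr => i _.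
  by rewrite linear_sum; apply: eq_bigr => j _; rewrite linearZ.
move=> X; apply: (@cvg_big _ _ +%R 0 _ (@add_continuous 'M[R]_(p, q)) _ (nbhs X)) =>
  i _.
apply: (@cvg_big _ _ +%R 0 _ (@add_continuous 'M[R]_(p, q)) _ (nbhs X)) => j _.
by apply: (@cvgZ _ _ _ (nbhs X)); [exact: coord_continuous|exact: cvg_cst].
Qed.

Lemma vspace_closed m n (W : {vspace 'M[R]_(m, n)}) : closed [set X | X \in W].
Proof.
have -> : [set X | X \in W] = (fun X => projv W X - X) @^-1` [set 0].
  apply/seteqP; split=> X /=; first by move=> /projv_id ->; rewrite subrr.
  by move=> /eqP; rewrite subr_eq0 => /eqP <-; exact: memv_proj.
apply: preimage_closed; last exact: mx_closed1.
move=> X _; apply: (@cvgB _ _ _ (nbhs X)); last exact: cvg_id.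
exact: (@linear_mx_continuous _ _ _ _ (projv W)).
Qed.

End MatrixTopology.

(** * Convex cones *)

Section Cones.
Variable R : realType.

Definition cone (V : lmodType R) (K : set V) : Prop :=
  [/\ K 0, forall x y, K x -> K y -> K (x + y) &
      forall c x, 0 <= c -> K x -> K (c *: x)].

Definition sharp (V : lmodType R) (K : set V) : Prop :=
  forall x, K x -> K (- x) -> x = 0.

Lemma cone_sum (V : lmodType R) (K : set V) I (r : seq I) (P : pred I) F :
  cone K -> (forall i, P i -> K (F i)) -> K (\sum_(i <- r | P i) F i).
Proof. by case=> K0 KD _ KF; apply: big_ind. Qed.

Lemma sharpD (V : lmodType R) (K : set V) x y :
  sharp K -> K x -> K y -> x + y = 0 -> x = 0.
Proof.
by move=> sK Kx Ky /eqP; rewrite addr_eq0 => /eqP xy; apply: sK; rewrite // xy opprK.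
Qed.

(* u is the sum of a basis of the span of K made of elements of K. *)
Lemma cone_order_unit (V : vectType R) (K : set V) : cone K ->
  exists2 u, K u & forall x, K x -> exists2 c, 0 <= c & K (c *: u - x).
Proof.
move=> cK; have [K0 KD KZ] := cK.
pose P d := `[< exists2 s : seq V, (forall x, x \in s -> K x) & \dim (span s) = d >].
have P0 : exists d, P d.
  by exists (\dim (span ([::] : seq V))); apply/asboolP; exists [::].
have Pub d : P d -> (d <= \dim {:V})%N.
  by move=> /asboolP[s _ <-]; apply: dimvS; apply: subvf.
case: (ex_maxnP P0 Pub) => d /asboolP[s sK sd] dmax.
exists (\sum_(i < size s) s`_i).
  by apply: cone_sum => // i _; apply: sK; apply: mem_nth.
move=> x Kx.
have xs : x \in (span s).
  have le : (\dim (span (x :: s)) <= \dim (span s))%N.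
    rewrite sd; apply: dmax; apply/asboolP; exists (x :: s) => // y.
    by rewrite inE => /orP[/eqP->|/sK].
  have /eqP-> : (span s) == span (x :: s).
    by rewrite eqEdim le andbT; apply: sub_span => y; rewrite inE orbC => ->.
  by apply: memv_span; rewrite inE eqxx.
pose a i := coord (in_tuple s) i x.
have xE : x = \sum_i a i *: s`_i := @coord_span _ _ _ (in_tuple s) x xs.
exists (\sum_i `|a i|); first exact: sumr_ge0.
rewrite xE scaler_sumr -sumrB; apply: cone_sum => // i _.
rewrite -scalerBl; apply: KZ; last by apply: sK; apply: mem_nth.
rewrite subr_ge0 (bigD1 i)//= (le_trans (ler_norm _))// lerDl.
exact: sumr_ge0.
Qed.

Section Euclidean.
Variables m n : nat.
Implicit Types (x y z w : 'M[R]_(m, n)) (K : set 'M[R]_(m, n)).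

(** The Frobenius inner product, needed for nearest points since the ambient norm is the maximum of
    the entries. *)
Definition dot x y : R := \tr (x^T *m y).

Lemma dotE x y : dot x y = \sum_i \sum_j x j i * y j i.
Proof.
apply: eq_bigr => i _; rewrite mxE; apply: eq_bigr => j _.
by rewrite mxE.
Qed.

Lemma dotC x y : dot x y = dot y x.
Proof. by rewrite /dot -mxtrace_tr trmx_mul trmxK. Qed.

Lemma dotDr x y z : dot x (y + z) = dot x y + dot x z.
Proof. by rewrite /dot mulmxDr mxtraceD. Qed.

Lemma dotZr x c y : dot x (c *: y) = c * dot x y.
Proof. by rewrite /dot -scalemxAr mxtraceZ. Qed.

Lemma dotDl x y z : dot (y + z) x = dot y x + dot z x.
Proof. by rewrite !(dotC _ x) dotDr. Qed.

Lemma dotZl x c y : dot (c *: y) x = c * dot y x.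
Proof. by rewrite !(dotC _ x) dotZr. Qed.

Lemma dotNr x y : dot x (- y) = - dot x y.
Proof. by rewrite -scaleN1r dotZr mulN1r. Qed.

Lemma dotNl x y : dot (- y) x = - dot y x.
Proof. by rewrite !(dotC _ x) dotNr. Qed.

Lemma dot0r x : dot x 0 = 0.
Proof. by rewrite /dot mulmx0 mxtrace0. Qed.

Lemma dot_entry x i j : x i j ^+ 2 <= dot x x.
Proof.
rewrite dotE (bigD1 j)//= (bigD1 i)//= -expr2 -addrA lerDl.
by rewrite addr_ge0// sumr_ge0// => ? _; rewrite ?sumr_ge0// => *;
  rewrite -expr2 sqr_ge0.
Qed.

Lemma dot_ge0 x : 0 <= dot x x.
Proof. by rewrite dotE; do 2![apply: sumr_ge0 => ? _]; rewrite -expr2 sqr_ge0. Qed.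

Lemma dot_eq0 x : dot x x = 0 -> x = 0.
Proof.
move=> x0; apply/matrixP => i j; rewrite mxE; apply/eqP.
by rewrite -sqrf_eq0 eq_le sqr_ge0 andbT -x0 dot_entry.
Qed.

Lemma cvg_dot T (F : set_system T) {FF : Filter F} (f g : T -> 'M[R]_(m, n)) x y :
  f @ F --> x -> g @ F --> y -> (fun t => dot (f t) (g t)) @ F --> dot x y.
Proof.
move=> fx gy; apply: cvg_trace; apply: cvg_mulmx => //.
apply/cvg_mxP => i j; under eq_fun do rewrite mxE; rewrite mxE.
by move/cvg_mxP: fx; apply.
Qed.

Lemma dot_continuous x : continuous (dot x).
Proof.
by move=> y; apply: (@cvg_dot _ (nbhs y) _ (fun=> x) id);
  [exact: cvg_cst|exact: cvg_id].
Qed.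

(** [w] points from [x] to its nearest point [y] in [K]. Minimality compared with [y + t *: z] gives
    [0 <= dot w z], compared with [y - t *: y] it gives [dot w y <= 0]; finally [x = y - w]. *)
Lemma separation K x : closed K -> cone K -> ~ K x ->
  exists2 w, (forall y, K y -> 0 <= dot w y) & dot w x < 0.
Proof.
move=> Kcl [K0 KD KZ] nKx.
pose q y := dot (y - x) (y - x).
have qc : continuous q.
  by move=> y; apply: (@cvg_dot _ (nbhs y)); apply: cvgB;
    [exact: cvg_id|exact: cvg_cst|exact: cvg_id|exact: cvg_cst].
pose A := K `&` [set y | q y <= q 0].
have Acl : closed A.
  apply: closedI => //.
  by apply: (preimage_closed _ (@closed_le _ (q 0))) => y _; exact: qc.
have Ab y : A y -> `|y| <= 1 + q 0 + `|x|.
  move=> [_ qy]; rewrite -[y](subrK x) (le_trans (ler_normD _ _))// lerD2r.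
  rewrite [leLHS]/normr/= mx_normrE; apply: bigmax_le => [|[i j] _].
    by rewrite addr_ge0// dot_ge0.
  rewrite -[leLHS]/(`|(y - x) i j|); set a := (y - x) i j.
  have : a ^+ 2 <= q 0 by apply: le_trans qy; exact: dot_entry.
  rewrite -real_normK ?num_real// => h.
  have := sqr_ge0 (`|a| - 1); have := normr_ge0 a; nra.
have [y /set_mem[Ky qy] ymin] : exists2 y, y \in A & forall t, t \in A -> q y <= q t.
  apply: compact_EVT_min; [by exists 0; split=> //=|exact: mx_compact Ab|].
  exact: continuous_subspaceT.
have {}ymin z : K z -> q y <= q z.
  move=> Kz; have [zq|/ltW] := leP (q z) (q 0); last exact: le_trans.
  by apply: ymin; apply: mem_set.
have [w wE] : exists w, w = y - x by exists (y - x).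
have qD t z : q (y + t *: z) = q y + 2 * t * dot w z + t ^+ 2 * dot z z.
  rewrite /q addrAC -wE !(dotDl, dotDr, dotZl, dotZr) (dotC z w).
  lra.
have wK z : K z -> 0 <= dot w z.
  move=> Kz; rewrite leNgt; apply/negP => wz.
  have zz : 0 < dot z z.
    rewrite lt_def dot_ge0 andbT; apply/eqP => /dot_eq0 z0.
    by move: wz; rewrite z0 dot0r ltxx.
  pose t := - dot w z / dot z z.
  have t0 : 0 <= t by rewrite divr_ge0 ?dot_ge0// oppr_ge0 ltW.
  have := ymin _ (KD _ _ Ky (KZ _ _ t0 Kz)).
  have tz : t * dot z z = - dot w z by rewrite mulfVK ?gt_eqF.
  rewrite qD expr2 -(mulrA t t) tz.
  have : 0 < t by rewrite divr_gt0// oppr_gt0.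
  nra.
exists w => //.
have wy : dot w y <= 0.
  rewrite leNgt; apply/negP => wy.
  have yy : 0 < dot y y.
    rewrite lt_def dot_ge0 andbT; apply/eqP => /dot_eq0 z0.
    by move: wy; rewrite z0 dot0r ltxx.
  (* The minimiser of the quadratic along [y - t *: y], cut off at 1 so that the point stays in
     [K]. *)
  pose t := Num.min 1 (dot w y / dot y y).
  have t0 : 0 < t by rewrite lt_min ltr01 divr_gt0.
  have t1 : t <= 1 by rewrite ge_min lexx.
  have ty : t * dot y y <= dot w y by rewrite -ler_pdivlMr// ge_min lexx orbT.
  have : K (y + (- t) *: y).
    by rewrite -[X in X + _]scale1r -scalerDl; apply: KZ => //; rewrite subr_ge0.
  move=> /ymin; rewrite qD sqrrN expr2 -(mulrA t t).
  nra.
have xE : x = y - w by rewrite wE opprB addrC subrK.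
rewrite xE dotDr dotNr.
have ww : 0 < dot w w.
  rewrite lt_def dot_ge0 andbT; apply/eqP => /dot_eq0 w0.
  by apply: nKx; rewrite xE w0 subr0.
lra.
Qed.

(* The functional is an order unit of the dual cone. *)
Lemma positive_functional K : closed K -> cone K -> sharp K ->
  exists w, forall x, K x -> x != 0 -> 0 < dot w x.
Proof.
move=> Kcl cK sK.
pose D : set 'M[R]_(m, n) := [set w | forall y, K y -> 0 <= dot w y].
have cD : cone D.
  split=> [y _|w z Dw Dz y Ky|c w c0 Dw y Ky].
  - by rewrite dotC dot0r.
  - by rewrite dotDl addr_ge0 ?Dw ?Dz.
  - by rewrite dotZl mulr_ge0 ?Dw.
have [w Dw wD] := cone_order_unit cD.
exists w => x Kx x0; rewrite lt_def Dw// andbT; apply: contra_neq x0 => wx.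
apply: sK => //; apply: contrapT => /(separation Kcl cK)[z Dz].
rewrite dotNr oppr_lt0 ltNge => /negP; apply.
have [c c0 /(_ x Kx)] := wD z Dz.
by rewrite dotDl dotNl dotZl wx mulr0 add0r oppr_ge0.
Qed.

(** By homogeneity [c] can be the minimum of [g] on the compact set of norm-one elements of [K]; if
    there are none, [K] is zero. *)
Lemma cone_lower_bound K (g : 'M[R]_(m, n) -> R) : closed K -> cone K ->
  continuous g -> (forall c x, 0 <= c -> g (c *: x) = c * g x) ->
  (forall x, K x -> x != 0 -> 0 < g x) ->
  exists2 c, 0 < c & forall x, K x -> c * `|x| <= g x.
Proof.
move=> Kcl [K0 KD KZ] gc gZ gK.
have g0 : g 0 = 0 by have := gZ 0 0 (lexx 0); rewrite scale0r mul0r.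
pose A := K `&` [set x | `|x| = 1].
have Acl : closed A.
  apply: closedI => //; apply: (preimage_closed _ (@closed_eq _ 1)) => y _.
  exact: (@norm_continuous R 'M[R]_(m, n)).
have [A0|A0] := pselect (A !=set0); last first.
  exists 1 => // x Kx; have [->|x0] := eqVneq x 0.
    by rewrite normr0 mulr0 g0.
  exfalso; apply: A0; exists (`|x|^-1 *: x).
  split; first by apply: KZ => //; rewrite invr_ge0.
  by rewrite /= normrZ ger0_norm ?invr_ge0// mulVf// normr_eq0.
have [y /set_mem[Ky y1] ymin] : exists2 y, y \in A & forall t, t \in A -> g y <= g t.
  apply: compact_EVT_min => //; last exact: continuous_subspaceT.
  by apply: (@mx_compact _ _ _ A 1) => // M [_ ->].
exists (g y).
  by apply: gK => //; rewrite -normr_eq0 y1 oner_eq0.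
move=> x Kx; have [->|x0] := eqVneq x 0.
  by rewrite normr0 mulr0 g0.
have x0' : 0 < `|x| by rewrite normr_gt0.
have : g y <= g (`|x|^-1 *: x).
  apply: ymin; apply: mem_set; split; first by apply: KZ => //; rewrite invr_ge0.
  by rewrite /= normrZ ger0_norm ?invr_ge0// mulVf// normr_eq0.
by rewrite gZ ?invr_ge0// mulrC ler_pdivlMr.
Qed.

End Euclidean.
End Cones.

(** * Traces, idempotents and the Auerbach lemma *)

Section LinearAlgebra.
Variable R : realType.

(** In a full-rank factorisation [A = C D] the hypothesis forces [D C = c], and [D C] has the trace
    of [A]. Both [c = 1] and [c = 0] are of use: the latter makes square-zero matrices traceless. *)
Lemma mxtrace_scaled_idem n (A : 'M[R]_n) c :
  A *m A = c *: A -> \tr A = c * (\rank A)%:R.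
Proof.
move=> AA; have AE := mulmx_base A.
have [L LC] := row_fullP (col_base_full A).
have [S DS] := row_freeP (row_base_free A).
move: (col_base A) (row_base A) AE L LC S DS => C D AE L LC S DS.
have DC : D *m C = c%:M.
  have : L *m (C *m D *m (C *m D)) *m S = L *m (c *: (C *m D)) *m S by rewrite AE AA.
  rewrite -scalemxAr -scalemxAl !mulmxA LC mul1mx -!mulmxA DS !mulmx1.
  by rewrite scalemx1.
by rewrite -{1}AE mxtrace_mulC DC mxtrace_scalar mulr_natr.
Qed.

Lemma idempotent_trace_eq0 n (A : 'M[R]_n) : A *m A = A -> \tr A = 0 -> A = 0.
Proof.
move=> AA trA; have := @mxtrace_scaled_idem n A 1; rewrite AA scale1r trA mul1r.
by move=> /(_ erefl)/esym/eqP; rewrite pnatr_eq0 mxrank_eq0 => /eqP.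
Qed.

(** Fitting decomposition: Bezout between ['X^(k.+1)] and the part [q] of the characteristic
    polynomial prime to ['X] gives the projector onto the part where [A] is invertible. The exponent
    [k.+1] ensures a factor ['X] even if [k = 0], which keeps the idempotent in any ideal containing
    [A]. *)
Lemma fitting_idempotent n (A : 'M[R]_n.+1) : (forall k, A ^+ k != 0) ->
  exists2 q, (let e := horner_mx A ('X * q) in e * e = e) &
    horner_mx A ('X * q) != 0.
Proof.
move=> An.
have [k [q q0 pE]] := multiplicity_XsubC (char_poly A) 0.
rewrite polyC0 subr0 in pE.
have /Bezout_eq1_coprimepP[[u v] /= uv] : coprimep ('X^(k.+1)) q.
  rewrite coprimep_expl// coprimep_sym -['X]subr0 -polyC0 coprimep_XsubC.
  by move: q0; rewrite monic_neq0 ?char_poly_monic.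
pose e := horner_mx A (u * 'X^(k.+1)).
have ed : e + horner_mx A (v * q) = 1 by rewrite -rmorphD/= uv rmorph1.
have dX (r : {poly R}) : horner_mx A (v * q * ('X^k * r) : {poly R}) = 0.
  rewrite (_ : _ * _ = char_poly A * (v * r)).
    by rewrite rmorphM/= Cayley_Hamilton mul0r.
  by rewrite pE (mulrC v q) mulrACA.
have uE : 'X * (u * 'X^k) = u * 'X^(k.+1) by rewrite mulrCA -exprS.
exists (u * 'X^k); rewrite uE -/e /=.
  have de : horner_mx A (v * q) * e = 0.
    rewrite -rmorphM/= -(dX ('X * u)); congr (horner_mx A (_ * _)).
    by rewrite exprSr mulrC mulrA.
  have -> : e * e = (1 - horner_mx A (v * q)) * e by rewrite -ed addrK.
  by rewrite mulrBl de subr0 mul1r.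
apply: contra (An k) => /eqP e0; move: ed; rewrite e0 add0r => d1.
have := dX 1; rewrite mulr1 (rmorphM (horner_mx A) (v * q))/= d1 mul1r.
by rewrite rmorphXn/= horner_mx_X => ->.
Qed.

Lemma horner_mx_mulX_mem n (A : 'M[R]_n.+1) (S : set 'M[R]_n.+1) :
  (forall X Y, S X -> S Y -> S (X + Y)) -> (forall c X, S X -> S (c *: X)) ->
  (forall X, S X -> S (A * X)) -> S A -> forall q, S (horner_mx A ('X * q)).
Proof.
move=> SD SZ SM SA; elim/poly_ind => [|q c IHq].
  by rewrite mulr0 rmorph0 -(scale0r A); exact: SZ.
rewrite mulrDr rmorphD/=; apply: SD; last first.
  rewrite mulrC mul_polyC linearZ/= horner_mx_X; exact: SZ.
rewrite (mulrC q) rmorphM/= horner_mx_X; exact: SM.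
Qed.

Lemma mulmx_norm_le m n p (A : 'M[R]_(m, n)) (B : 'M[R]_(n, p)) :
  `|A *m B| <= n%:R * (`|A| * `|B|).
Proof.
rewrite [leLHS]/normr/= mx_normrE; apply: bigmax_le => [|[i j] _].
  by rewrite !mulr_ge0.
rewrite -[leLHS]/(`|(A *m B) i j|) mxE (le_trans (ler_norm_sum _ _ _))//.
rewrite mulr_natl -[X in _ *+ X]card_ord -sumr_const; apply: ler_sum => k _.
by rewrite normrM ler_pM// entry_le_norm.
Qed.

Lemma singular_vector n (A : 'M[R]_n) : \det A = 0 ->
  exists2 v : 'cV[R]_n, v != 0 & A *m v = 0.
Proof.
rewrite -det_tr => /eqP/det0P[v v0 vA]; exists v^T; first by rewrite trmx_eq0.
by rewrite -[A]trmxK -trmx_mul vA trmx0.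
Qed.

Lemma det_eigen n (A : 'M[R]_n) r (v : 'cV[R]_n) :
  v != 0 -> A *m v = r *: v -> \det (r%:M - A) = 0.
Proof.
move=> v0 Av; apply/eqP; apply: contraNT v0 => d0.
have u : r%:M - A \in unitmx by rewrite unitmxE unitfE.
by rewrite -(mulKmx u v) mulmxBl Av mul_scalar_mx subrr mulmx0.
Qed.

Lemma eigenvalue_le_norm n (A : 'M[R]_n) r :
  \det (r%:M - A) = 0 -> `|r| <= n%:R * `|A|.
Proof.
move=> /singular_vector[v v0]; rewrite mulmxBl mul_scalar_mx => /eqP.
rewrite subr_eq0 => /eqP rv; have v0' : 0 < `|v| by rewrite normr_gt0.
by rewrite -(ler_pM2r v0') -normrZ rv -mulrA mulmx_norm_le.
Qed.

(* If M maximises |det M| among the matrices with columns in B, Cramer's rule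
   bounds the coordinates of the points of B in the basis M by 1. *)
Lemma auerbach n (B : set 'cV[R]_n) : compact B ->
  (exists2 d : R, 0 < d & forall z : 'cV_n, `|z| <= d -> B z) ->
  exists2 M : 'M[R]_n, M \in unitmx &
    (forall j, B (col j M)) /\ forall x j, B x -> `|(invmx M *m x) j 0| <= 1.
Proof.
move=> Bc [d d0 dB].
pose A := [set M : 'M[R]_n | forall j, B (col j M)].
have Bcl : closed B by apply: compact_closed => //; exact: norm_hausdorff.
have Acl : closed A.
  have -> : A = \bigcap_(j in setT) ((fun M : 'M[R]_n => col j M) @^-1` B).
    by apply/seteqP; split=> [M AM j _|M AM j]; apply: AM.
  apply: closed_bigI => j _; apply: preimage_closed => // M _.
  apply/(@cvg_mxP _ _ (nbhs M)) => i k; under eq_fun do rewrite mxE; rewrite mxE.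
  exact: coord_continuous.
have [b Bb] : exists b, forall x, B x -> `|x| <= b.
  have [b [_ Bb]] := compact_bounded Bc.
  by exists (b + 1) => x Bx; apply: (Bb (b + 1)); rewrite ?ltrDl.
have Ab M : A M -> `|M| <= `|b|.
  move=> AM; rewrite [leLHS]/normr/= mx_normrE; apply: bigmax_le => // [[i j] _].
  rewrite -[leLHS]/(`|M i j|) (le_trans _ (ler_norm _))//.
  have := Bb _ (AM j); apply: le_trans.
  by have := entry_le_norm (col j M) i 0; rewrite mxE.
have Ad : A d%:M.
  move=> j; apply: dB; rewrite [leLHS]/normr/= mx_normrE; apply: bigmax_le =>
    [|[i k] _].
    exact: ltW.
  rewrite -[leLHS]/(`|(col j d%:M) i k|) !mxE normrMn (ger0_norm (ltW d0)).
  by case: (_ == _); rewrite ?mulr1n ?mulr0n// ltW.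
have [M /set_mem AM Mmax] : exists2 M, M \in A & forall N, N \in A ->
  `|\det N| <= `|\det M|.
  apply: compact_EVT_max; [by exists d%:M|exact: mx_compact Ab|].
  apply: continuous_subspaceT => M.
  exact: (continuous_comp (@det_continuous _ _ M) (@norm_continuous _ R^o _)).
have dM : 0 < `|\det M|.
  apply: lt_le_trans (Mmax _ (mem_set Ad)).
  by rewrite det_scalar normrX exprn_gt0// normr_gt0 gt_eqF.
have uM : M \in unitmx by rewrite unitmxE unitfE -normr_gt0.
exists M => //; split=> // x j Bx.
pose N : 'M[R]_n := \matrix_(i, k) if k == j then x i 0 else M i k.
have AN : A N.
  move=> k; have [->|kj] := eqVneq k j.
    suff -> : col j N = x by [].
    by apply/matrixP => i l; rewrite !mxE eqxx (ord1 l).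
  suff -> : col k N = col k M by [].
  by apply/matrixP => i l; rewrite !mxE (negbTE kj).
have NE : \det N = \det M * (invmx M *m x) j 0.
  rewrite /invmx uM -scalemxAl mxE mulrA divff -?normr_gt0// mul1r.
  rewrite (expand_det_col N j) mxE; apply: eq_bigr => i _.
  rewrite !mxE eqxx mulrC; congr (_ * _); congr (_ * \det _).
  apply/matrixP => a c; rewrite !mxE.
  by rewrite eq_sym (negbTE (neq_lift _ _)).
have := Mmax _ (mem_set AN); rewrite NE normrM -[leRHS]mulr1.
by rewrite ler_pM2l.
Qed.

(** In an Auerbach basis of [B] the basis vectors lie in [B] and their images in [t B], so every
    diagonal entry of [Z] is at most [t] in absolute value. *)
Lemma trace_le_compact_body n (B : set 'cV[R]_n) (Z : 'M[R]_n) t : compact B ->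
  (exists2 d : R, 0 < d & forall z : 'cV_n, `|z| <= d -> B z) -> 0 <= t ->
  (forall x, B x -> exists2 y, B y & Z *m x = t *: y) -> `|\tr Z| <= n%:R * t.
Proof.
move=> Bc Bd t0 ZB; have [M uM [BM Bx]] := auerbach Bc Bd.
have -> : \tr Z = \tr (invmx M *m (Z *m M)).
  by rewrite mxtrace_mulC -mulmxA mulmxV// mulmx1.
rewrite /mxtrace (le_trans (ler_norm_sum _ _ _))//.
rewrite mulr_natl -[X in _ *+ X]card_ord -sumr_const; apply: ler_sum => j _.
have -> : (invmx M *m (Z *m M)) j j = (invmx M *m (Z *m col j M)) j 0.
  rewrite !mxE; apply: eq_bigr => k _; rewrite !mxE; congr (_ * _).
  by apply: eq_bigr => l _; rewrite !mxE.
have [y By ->] := ZB _ (BM j).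
by rewrite -scalemxAr mxE normrM ger0_norm// ler_piMr// Bx.
Qed.

End LinearAlgebra.

(** * The Perron-Frobenius property *)

Section PerronFrobenius.
Variable R : realType.

(* Perron-Frobenius property: r plays the role of the spectral radius. Both clauses
   depend only on the conjugacy class of X and pass to limits; the trace bound
   prevents r from vanishing in a limit which is not traceless. *)
Definition PF n (X : 'M[R]_n) : Prop :=
  exists r, [/\ 0 <= r, \det (r%:M - X) = 0 & `|\tr X| <= n%:R * r].

(** The roots stay bounded by [eigenvalue_le_norm], so they converge along the ultrafilter, and the
    three conditions are closed. *)
Lemma PF_ultra T (F : set_system T) (FU : UltraFilter F) n (f : T -> 'M[R]_n)
  (X : 'M[R]_n) :
  f @ F --> X -> (\forall t \near F, PF (f t)) -> PF X.
Proof.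
move=> fX fPF.
have [r rP] : {r : T -> R & forall t, PF (f t) ->
    [/\ 0 <= r t, \det ((r t)%:M - f t) = 0 & `|\tr (f t)| <= n%:R * r t]}.
  apply: (@choice _ _ (fun t r => PF (f t) -> [/\ 0 <= r, \det (r%:M - f t) = 0 &
    `|\tr (f t)| <= n%:R * r])) => t.
  by have [[r rP]|nP] := pselect (PF (f t)); [exists r|exists 0].
have fb : \forall t \near F, `|f t| <= `|X| + 1.
  have /cvgr_norm_le := fX; apply; rewrite ltrDl//.
have rb : \forall t \near F, `|r t| <= n%:R * (`|X| + 1).
  apply: filterS2 fb fPF => t ft /rP[_ dt _].
  by rewrite (le_trans (eigenvalue_le_norm dt))// ler_wpM2l.
have [s rs] := ultra_bounded_real FU rb.
exists s; split.
- have : \forall t \near F, 0 <= r t by apply: filterS fPF => t /rP[].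
  move=> r0; exact: (closed_cvg _ (@closed_ge _ 0) r0).
- have dc : (fun t => \det ((r t)%:M - f t)) @ F --> \det (s%:M - X).
    apply: cvg_det; apply: cvgB => //.
    apply/cvg_mxP => i j; under eq_fun do rewrite mxE; rewrite mxE.
    exact: cvgMn.
  have d0 : \forall t \near F, \det ((r t)%:M - f t) = 0 by apply: filterS fPF =>
    t /rP[].
  exact: (closed_cvg _ (@closed_eq _ 0) d0).
- have tc : (fun t => n%:R * r t - `|\tr (f t)|) @ F --> n%:R * s - `|\tr X|.
    apply: cvgB; first by apply: cvgM => //; exact: cvg_cst.
    by apply: cvg_norm; exact: cvg_trace.
  have t0 : \forall t \near F, 0 <= n%:R * r t - `|\tr (f t)|.
    by apply: filterS fPF => t /rP[_ _]; rewrite subr_ge0.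
  rewrite -subr_ge0; exact: (closed_cvg _ (@closed_ge _ 0) t0).
Qed.

Lemma PF_closed n : closed [set X : 'M[R]_n | PF X].
Proof. by apply: closed_ultra => F X FU FX FP; exact: (@PF_ultra _ F FU n id). Qed.

Section PreservedCone.
Variables (n : nat) (K : set 'cV[R]_n.+1).
Hypotheses (Kcl : closed K) (cK : cone K) (sK : sharp K).

Let K0 : K 0. Proof. by case: cK. Qed.
Let KD x y : K x -> K y -> K (x + y). Proof. by case: cK => _ KD _; apply: KD. Qed.
Let KZ c x : 0 <= c -> K x -> K (c *: x). Proof. by case: cK => _ _ KZ; apply: KZ. Qed.

Definition interior_point (u : 'cV[R]_n.+1) : Prop :=
  exists2 d : R, 0 < d & forall z : 'cV_n.+1, `|z| <= d -> K (u + z).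

Lemma interior_point_neq0 u : interior_point u -> u != 0.
Proof.
move=> [d d0 Ku]; apply/eqP => u0.
pose z : 'cV[R]_n.+1 := const_mx d.
have zn : `|z| = d.
  apply/le_anti/andP; split.
    rewrite [leLHS]/normr/= mx_normrE; apply: bigmax_le => [|[i j] _]; first exact: ltW.
    by rewrite -[leLHS]/(`|z i j|) mxE ger0_norm// ltW.
  by have := entry_le_norm z 0 0; rewrite mxE ger0_norm// ltW.
have : z = 0.
  apply: sK; first by have := Ku z; rewrite u0 add0r; apply; rewrite zn.
  by have := Ku (- z); rewrite u0 add0r normrN; apply; rewrite zn.
by move=> /eqP; rewrite -normr_eq0 zn gt_eqF.
Qed.

Lemma interior_point_mem u : interior_point u -> K u.
Proof. by move=> [d d0 /(_ 0)]; rewrite normr0 addr0; apply; exact: ltW. Qed.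

(* Collatz-Wielandt: the largest r with X x - r x in K for some nonzero x in K is an
   eigenvalue, with an interior eigenvector x. The order interval between - x and x
   is then a convex body which X maps into its dilate by r. *)
Lemma PF_strictly_positive (X : 'M[R]_n.+1) : (exists2 x, K x & x != 0) ->
  (forall x, K x -> x != 0 -> interior_point (X *m x)) -> PF X.
Proof.
move=> [x0 Kx0 x00] XK.
have [w wK] := positive_functional Kcl cK sK.
have w0 x : K x -> 0 <= dot w x.
  move=> Kx; have [->|xn0] := eqVneq x 0; first by rewrite dot0r.
  exact/ltW/wK.
have [c c0 cw] : exists2 c, 0 < c & forall x, K x -> c * `|x| <= dot w x.
  apply: cone_lower_bound => //; [exact: dot_continuous|by move=> *; rewrite dotZr].
have XK' x : K x -> K (X *m x).
  move=> Kx; have [->|xn0] := eqVneq x 0; first by rewrite mulmx0.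
  by apply: interior_point_mem; apply: XK.
pose B := K `&` [set x | dot w x = 1].
have Bcl : closed B.
  apply: closedI => //; apply: (preimage_closed _ (@closed_eq _ 1)) => y _.
  exact: dot_continuous.
have Bc : compact B.
  apply: (@mx_compact _ _ _ B c^-1) => // x [Kx /= wx].
  by rewrite -(ler_pM2l c0) divff ?gt_eqF// -wx cw.
have normB x : K x -> x != 0 -> B ((dot w x)^-1 *: x).
  move=> Kx xn0; have wx := wK _ Kx xn0; split; first by apply: KZ;
    rewrite ?invr_ge0 ?ltW.
  by rewrite /= dotZr mulVf ?gt_eqF.
have B0 : B !=set0 by exists ((dot w x0)^-1 *: x0); apply: normB.
have Xw : continuous (fun x => dot w (X *m x)).
  move=> x; exact: (continuous_comp (@mulmx_continuous _ _ _ _ X x)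
    (@dot_continuous _ _ _ w _)).
have [xm _ xmax] := compact_EVT_max B0 Bc (continuous_subspaceT Xw).
(* [M] bounds every admissible [r], which makes the set [A] of admissible pairs compact. *)
pose M := dot w (X *m xm).
have tM t x : B x -> K (X *m x - t *: x) -> t <= M.
  move=> [Kx /= wx] /w0; rewrite dotDr dotNr dotZr wx mulr1 subr_ge0 => /le_trans;
    apply.
  by apply: xmax; apply: mem_set.
pose A : set (R * 'cV[R]_n.+1) :=
  (`[0, M] `*` B) `&` [set p | K (X *m p.2 - p.1 *: p.2)].
have Ac : compact A.
  apply: subclosed_compact (compact_setX (@segment_compact _ 0 M) Bc) _; last by move=>
    p [].
  apply: closedI; first by apply: compact_closed;
    [exact: norm_hausdorff|exact: (compact_setX (@segment_compact _ 0 M) Bc)].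
  apply: preimage_closed => // p _; apply: cvgB.
    apply: cvg_mulmx; [exact: cvg_cst|exact: cvg_snd].
  by apply: cvgZ; [exact: cvg_fst|exact: cvg_snd].
have AP t x : 0 <= t -> B x -> K (X *m x - t *: x) -> A (t, x).
  by move=> t0 Bx Kt; split=> //=; split=> //=; rewrite in_itv/= t0 (tM _ _ Bx).
have A0 : A !=set0.
  have [b Bb] := B0; exists (0, b); apply: AP => //; rewrite scale0r subr0.
  by apply: XK'; case: Bb.
have fstc : continuous (fst : R * 'cV[R]_n.+1 -> R) by move=> p; exact: cvg_fst.
have [[r x] /set_mem Arx rmax] := compact_EVT_max A0 Ac (continuous_subspaceT fstc).
have [[/= rM Bx] Krx] := Arx; have [Kx /= wx] := Bx.
have r0 : 0 <= r by move: rM; rewrite in_itv/= => /andP[].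
have xn0 : x != 0 by apply/eqP => xz; move: wx; rewrite xz dot0r => /esym/eqP;
  rewrite oner_eq0.
have Xxi := XK _ Kx xn0; have Xxn0 := interior_point_neq0 Xxi.
have Xxr : X *m x = r *: x.
  apply/eqP; rewrite -subr_eq0; apply: contraT => yn0.
  have [d d0 Kd] := XK _ Krx yn0.
  (* If [X *m x - r *: x] is nonzero, its image under [X] is interior; this leaves room to raise [r]
     to [r + h] at the vector [X *m x]. *)
  pose h := d / (`|X *m x| + 1).
  have h0 : 0 < h by rewrite divr_gt0// ltr_wpDl.
  have KX := XK' _ Kx.
  have : A (r + h, (dot w (X *m x))^-1 *: (X *m x)).
    apply: AP; [by rewrite addr_ge0// ltW|exact: normB|].
    rewrite -scalemxAr scalerA mulrC -scalerA -scalerBr; apply: KZ;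
      first by rewrite invr_ge0 w0.
    have -> : X *m (X *m x) - (r + h) *: (X *m x) =
      X *m (X *m x - r *: x) - h *: (X *m x).
      by rewrite mulmxBr -scalemxAr scalerDl opprD addrA.
    apply: Kd; rewrite normrN normrZ (ger0_norm (ltW h0)) /h mulrAC ler_pdivrMr
      ?ltr_wpDl//.
    by rewrite ler_pM2l// lerDl.
  move=> /mem_set/rmax /=; rewrite gerDl leNgt h0//.
have r_gt0 : 0 < r.
  by rewrite lt_def r0 andbT; apply: contra_neq Xxn0 => r00; rewrite Xxr r00 scale0r.
exists r; split=> //; first exact: det_eigen xn0 Xxr.
have [d d0 Kd] := Xxi.
pose C := [set z | K (x - z) /\ K (x + z)].
have Ccl : closed C.
  have -> : C = (fun z => x - z) @^-1` K `&` (fun z => x + z) @^-1` K by [].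
  apply: closedI; apply: preimage_closed => // z _.
    by apply: (@cvgB _ _ _ (nbhs z)); [exact: cvg_cst|exact: cvg_id].
  by apply: (@cvgD _ _ _ (nbhs z)); [exact: cvg_cst|exact: cvg_id].
apply: (@trace_le_compact_body _ _ C) => //.
- apply: (@mx_compact _ _ _ C (c^-1 * 2 + `|x|)) => // z [Kz1 Kz2].
  have zE : z = (x + z) - x by rewrite addrAC subrr add0r.
  rewrite {1}zE (le_trans (ler_normB _ _))// lerD2r ler_pdivlMl//.
  rewrite (le_trans (cw _ Kz2))//.
  by have := w0 _ Kz1; rewrite !dotDr dotNr wx; lra.
- have K' z : `|z| <= d / r -> K (x + z).
    move=> zd; have -> : x + z = r^-1 *: (X *m x + r *: z).
      by rewrite Xxr -scalerDr scalerA mulVf ?scale1r ?gt_eqF.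
    apply: KZ; first by rewrite invr_ge0.
    by apply: Kd; rewrite normrZ ger0_norm// mulrC -ler_pdivlMr.
  exists (d / r); first exact: divr_gt0.
  by move=> z zd; split; apply: K'; rewrite ?normrN.
- move=> z [Kz1 Kz2]; exists (r^-1 *: (X *m z)).
    have xE : x = r^-1 *: (X *m x) by rewrite Xxr scalerA mulVf ?scale1r ?gt_eqF.
    split.
      rewrite {1}xE -scalerBr -mulmxBr; apply: KZ; [by rewrite invr_ge0|exact: XK'].
    rewrite {1}xE -scalerDr -mulmxDr; apply: KZ; [by rewrite invr_ge0|exact: XK'].
  by rewrite scalerA divff ?scale1r ?gt_eqF.
Qed.

(** Adding a small multiple of the rank-one map [u *m w^T], with [w] positive on [K], makes [X]
    strictly positive; the property then passes to the limit. *)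
Lemma PF_cone (X : 'M[R]_n.+1) u : interior_point u ->
  (forall x, K x -> K (X *m x)) -> PF X.
Proof.
move=> ui XK.
have [w wK] := positive_functional Kcl cK sK.
pose Y k := X + (@harmonic R k) *: (u *m w^T).
have YX : Y @ \oo --> X.
  rewrite -[X in _ --> X]addr0; apply: cvgD; first exact: cvg_cst.
  rewrite -(scale0r (u *m w^T)); apply: cvgZ; [exact: cvg_harmonic|exact: cvg_cst].
apply: (closed_cvg _ (@PF_closed n.+1) _ _ YX); apply: nearW => k /=.
have [d d0 Kd] := ui.
apply: PF_strictly_positive.
  by exists u; [exact: interior_point_mem|exact: interior_point_neq0].
move=> x Kx xn0; have wx := wK _ Kx xn0.
pose e := harmonic k * dot w x.
have e0 : 0 < e by rewrite mulr_gt0// harmonic_gt0.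
exists (e * d); first exact: mulr_gt0.
move=> z ze.
have -> : Y k *m x + z = X *m x + e *: (u + e^-1 *: z).
  rewrite mulmxDl -scalemxAl -mulmxA [w^T *m x]mx11_scalar -/(dot w x).
  have -> : (w^T *m x) 0 0 = dot w x by rewrite /dot [w^T *m x]mx11_scalar
    mxtrace_scalar mxE eqxx !mulr1n.
  rewrite mul_mx_scalar scalerA -/e scalerDr scalerA divff ?gt_eqF// scale1r addrA//.
apply: KD; first exact: XK.
apply: KZ; first exact: ltW.
by apply: Kd; rewrite normrZ normfV (gtr0_norm e0) ler_pdivrMl.
Qed.

End PreservedCone.
End PerronFrobenius.

(** * Closed semirings of matrices *)

Section DivisionCone.
Variable R : realType.

Lemma cvg_adj T (F : set_system T) {FF : Filter F} n (f : T -> 'M[R]_n) (M : 'M[R]_n) :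
  f @ F --> M -> (fun t => \adj (f t)) @ F --> \adj M.
Proof.
move=> /cvg_mxP fM; apply/cvg_mxP => i j.
under eq_fun do rewrite mxE; rewrite mxE; apply: cvgM; first exact: cvg_cst.
apply: cvg_det; apply/cvg_mxP => k l.
under eq_fun do rewrite !mxE; rewrite !mxE; exact: fM.
Qed.

Lemma cvg_invmx T (F : set_system T) {FF : Filter F} n (f : T -> 'M[R]_n)
    (M : 'M[R]_n) :
  f @ F --> M -> M \in unitmx -> (forall t, f t \in unitmx) ->
  (fun t => invmx (f t)) @ F --> invmx M.
Proof.
move=> fM uM uf.
rewrite (_ : (fun t => invmx (f t)) = (fun t => (\det (f t))^-1 *: \adj (f t))).
  rewrite /invmx uM; apply: cvgZ; last exact: cvg_adj.
  by apply: cvgV; [rewrite -unitfE -unitmxE|exact: cvg_det].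
by apply/funext => t; rewrite /invmx uf.
Qed.

Section Cone.
Variables (l : nat) (T : set 'M[R]_l).
Hypotheses (Tcl : closed T) (cT : cone T) (sT : sharp T).
Hypothesis TM : forall A B, T A -> T B -> T (A *m B).
Hypothesis TU : forall A, T A -> A != 0 -> A \in unitmx.

Let TZ c A : 0 <= c -> T A -> T (c *: A). Proof. by case: cT => _ _; apply. Qed.
Let TD A B : T A -> T B -> T (A + B). Proof. by case: cT => _ TD _; apply: TD. Qed.

(* The normalised powers of A accumulate at an invertible matrix, so a rescaled
   power A^(m-1) comes close to A^-1. *)
Lemma division_cone_inv A : T A -> A != 0 -> T (invmx A).
Proof.
move=> TA A0; have uA := TU TA A0.
(* [p k] is the power [k + 1] of [A]; hence the shift by two in [pE]. *)
pose p k : 'M[R]_l := iter k (mulmx A) A.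
have Tp k : T (p k) by elim: k => //= k IHk; apply: TM.
have up k : p k \in unitmx by elim: k => //= k IHk; rewrite unitmx_mul uA.
have p0 k : p k != 0.
  apply: contra_neq A0 => pk; have := up k; rewrite pk => /mulmxV.
  by rewrite mul0mx => /(congr1 (mulmx A)); rewrite mulmx0 mulmx1.
have pE k m : p (k + m).+2 = p k *m (A *m p m).
  by elim: k => //= k IHk; rewrite -mulmxA -IHk.
pose x k := `|p k|^-1 *: p k.
have Tx k : T (x k) by apply: TZ; rewrite ?invr_ge0.
have x1 k : `|x k| = 1 by rewrite normrZ normfV normr_id mulVf ?normr_eq0.
have ux k : x k \in unitmx by apply: TU => //; rewrite -normr_eq0 x1 oner_eq0.
have [F [FU oF]] := ultraFilterLemma (@eventually_filter).
have [|Z xZ] := @ultra_bounded _ _ F FU _ _ x 1.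
  by apply: nearW => k; rewrite x1.
have TZl : T Z by apply: (closed_cvg _ Tcl _ _ xZ); exact: nearW.
have Z1 : `|Z| = 1.
  apply: (closed_cvg _ (@closed_eq _ 1) _ _ (cvg_norm xZ)); exact: nearW.
have uZ : Z \in unitmx by apply: TU => //; rewrite -normr_eq0 Z1 oner_eq0.
have Tk k : T (invmx A *m invmx (x k) *m Z).
  have cZ : (fun i => invmx A *m invmx (x k) *m x i) @ F -->
    invmx A *m invmx (x k) *m Z.
    by apply: cvg_mulmx => //; exact: cvg_cst.
  apply: (closed_cvg _ Tcl _ _ cZ); apply: oF.
  exists k.+2 => // i /= ki.
  rewrite -(subnKC ki) -[(_ + _)%N]/((k + (i - k.+2)).+2) -scalemxAr pE.
  apply: TZ; first by rewrite invr_ge0.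
  rewrite /x invmxZ ?unitmxZ ?unitfE ?invr_eq0 ?normr_eq0// invrK.
  rewrite -!scalemxAr -!scalemxAl -mulmxA mulKmx// mulKmx//.
  exact: TZ.
have cA : (fun k => invmx A *m invmx (x k) *m Z) @ F --> invmx A *m invmx Z *m Z.
  apply: cvg_mulmx; last exact: cvg_cst.
  by apply: cvg_mulmx; [exact: cvg_cst|exact: cvg_invmx].
by rewrite -mulmxA mulVmx// mulmx1 in cA; apply: (closed_cvg _ Tcl _ _ cA);
  exact: nearW.
Qed.

(* T \ 0 is a group by division_cone_inv, so 1 is an order unit. If s is maximal with
   B = A - s in T and B <> 0, then B^-1 <= d, hence B >= d^-1, contradicting the
   maximality of s. *)
Lemma division_cone_scalar E : T E -> E != 0 ->
  T 1%:M /\ forall A, T A -> exists c, A = c%:M.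
Proof.
move=> TE E0.
have T1 : T 1%:M by rewrite -(mulmxV (TU TE E0)); apply: TM;
  [|exact: division_cone_inv].
have one0 : 1%:M != 0 :> 'M[R]_l.
  by apply: contra_neq E0 => h; rewrite -[E]mulmx1 h mulmx0.
have [u Tu uT] := cone_order_unit cT.
have u0 : u != 0.
  apply: contra_neq E0 => u0; have [c _] := uT _ TE.
  by rewrite u0 scaler0 sub0r => /(sT TE).
have oneT A : T A -> exists2 c, 0 <= c & T (c%:M - A).
  move=> TA; have [c c0 /(TM (division_cone_inv Tu u0))] := uT _ (TM Tu TA).
  by rewrite mulmxBr -scalemxAr mulVmx ?TU// mulKmx ?TU// scalemx1 => ?; exists c.
split=> // A TA; have [c c0 cA] := oneT _ TA.
have sc s : T (A - s%:M) -> s <= c.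
  move=> TAs; rewrite leNgt; apply/negP => cs.
  have : T (c - s)%:M by rewrite raddfB/= -[c%:M](subrK A) -addrA; apply: TD.
  have sc0 : 0 <= (s - c)^-1 by rewrite invr_ge0 subr_ge0 ltW.
  move=> /(TZ sc0); rewrite -scalemx1 scalerA -(opprB s c) mulrN mulVf ?scaleN1r.
    by move=> /(sT T1) h; move: one0; rewrite h eqxx.
  by rewrite subr_eq0 gt_eqF.
pose S : set R := `[0, c] `&` [set s | T (A - s%:M)].
have Sc : compact S.
  apply: subclosed_compact (@segment_compact _ 0 c) _ => [|s []//].
  apply: closedI; first exact: interval_closed.
  apply: preimage_closed => // s _; apply: (@cvgB _ _ _ (nbhs s)); first exact: cvg_cst.
  apply/(@cvg_mxP _ _ (nbhs s)) => i j; under eq_fun do rewrite mxE; rewrite mxE.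
  by apply: cvgMn; exact: cvg_id.
have S0 : S !=set0.
  by exists 0; split; rewrite /= ?in_itv/= ?lexx ?c0// raddf0 subr0.
have idc : continuous (@id R) by move=> s; exact: cvg_id.
have [s /set_mem[/=]] := compact_EVT_max S0 Sc (continuous_subspaceT idc).
rewrite in_itv/= => /andP[s0 _] Ts smax.
exists s; apply/eqP; rewrite -subr_eq0; apply: contraT => B0.
have TB := division_cone_inv Ts B0; have uB := TU Ts B0.
have [d d0 /(TM Ts)] := oneT _ TB.
rewrite mulmxBr mulmxV// mul_mx_scalar => dB.
have d_gt0 : 0 < d.
  rewrite lt_def d0 andbT; apply/eqP => dz; move: dB.
  by rewrite dz scale0r sub0r => /(sT T1) h; move: one0; rewrite h eqxx.
have : T (A - (s + d^-1)%:M).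
  rewrite raddfD/= opprD addrA.
  have -> : A - s%:M - d^-1%:M = d^-1 *: (d *: (A - s%:M) - 1%:M).
    by rewrite scalerBr scalerA mulVf ?gt_eqF// scale1r scalemx1.
  by apply: TZ; rewrite // invr_ge0.
move=> h; have : S (s + d^-1) by split=> //=;
  rewrite in_itv/= sc// andbT addr_ge0// invr_ge0.
by move=> /mem_set/smax; rewrite gerDl invr_le0 leNgt d_gt0.
Qed.

End Cone.
End DivisionCone.

(** * Sharpness, ideals and idempotents of a semiring with nondegenerate trace form *)

Section MatrixSemiring.
Variable R : realType.

Lemma exp_mulmxC m n k (C : 'M[R]_(m, n)) (D : 'M[R]_(n, m)) :
  (C *m D) ^+ k.+1 = C *m (D *m C) ^+ k *m D.
Proof.
elim: k => [|k IHk]; first by rewrite expr1 expr0 mulmx1.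
by rewrite exprS IHk [in RHS]exprS -!mulmxE !mulmxA.
Qed.

(** In a full-rank factorisation [A = C D], the matrix [D C] has the trace of [A] and a smaller
    nilpotency exponent. *)
Lemma mxtrace_nilpotent k n (A : 'M[R]_n) : A ^+ k = 0 -> \tr A = 0.
Proof.
elim: k n A => [|k IHk] n A; first by rewrite expr0 => h;
  rewrite -[A]mul1r h mul0r mxtrace0.
have AE := mulmx_base A.
have [L LC] := row_fullP (col_base_full A).
have [S DS] := row_freeP (row_base_free A).
move: (col_base A) (row_base A) AE L LC S DS => C D AE L LC S DS.
rewrite -{1}AE exp_mulmxC => /(congr1 (fun B => L *m B *m S)).
rewrite mulmx0 mul0mx -!mulmxA DS mulmx1 mulmxA LC mul1mx => /IHk.
by rewrite mxtrace_mulC AE.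
Qed.

Variables (n : nat) (K : set 'M[R]_n.+1).
Hypotheses (Kcl : closed K) (cK : cone K) (K1 : K 1).
Hypothesis KM : forall X Y, K X -> K Y -> K (X * Y).
Hypothesis KPF : forall X, K X -> PF X.
Hypothesis Knd : forall X, K X -> (forall Y, K Y -> \tr (X * Y) = 0) -> X = 0.

Let KZ c X : 0 <= c -> K X -> K (c *: X). Proof. by case: cK => _ _; apply. Qed.
Let KD X Y : K X -> K Y -> K (X + Y). Proof. by case: cK => _ KD _; apply: KD. Qed.

(* Otherwise K contains - e for a nonzero idempotent e, which has no positive
   eigenvalue. *)
Lemma semiring_sharp : sharp K.
Proof.
move=> X KX KNX; apply: contrapT => X0.
have [Y KY trXY] : exists2 Y, K Y & \tr (X * Y) != 0.
  apply: contrapT => nY; apply: X0; apply: Knd => // Y KY; apply/eqP.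
  by apply: contrapT => /negP h; apply: nY; exists Y.
pose Z := X * Y.
pose S : set 'M[R]_n.+1 := [set U | K U /\ K (- U)].
have SZ : S Z by split; [exact: KM|rewrite -mulNr; exact: KM].
have [q ee e0] : exists2 q, (let e := horner_mx Z ('X * q) in e * e = e) &
    horner_mx Z ('X * q) != 0.
  apply: fitting_idempotent => k; apply: contra_neq trXY; exact: mxtrace_nilpotent.
have [_] : S (horner_mx Z ('X * q)).
  apply: horner_mx_mulX_mem => //.
  - by move=> U V [KU KNU] [KV KNV]; split; rewrite ?opprD; apply: KD.
  - move=> c U [KU KNU]; have [c0|/ltW c0] := leP 0 c.
      by split; rewrite -?scalerN; apply: KZ.
    have nc0 : 0 <= - c by rewrite oppr_ge0.
    by split; [rewrite -[c]opprK scaleNr -scalerN|rewrite -scaleNr]; apply: KZ.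
  - by move=> U [KU KNU]; split; rewrite -?mulrN; apply: KM => //; case: SZ.
move: (horner_mx _ _) ee e0 => /= e ee e0 /KPF[r [r0]].
move=> /singular_vector[v v0]; rewrite opprK mulmxDl mul_scalar_mx => /eqP.
rewrite addrC addr_eq0 => /eqP ev.
have : e *m (e *m v) = e *m v by rewrite mulmxA mulmxE ee.
rewrite ev mulmxN -scalemxAr ev scalerN opprK scalerA -scaleNr => /eqP.
rewrite -subr_eq0 -scalerBl scaler_eq0 (negbTE v0) orbF opprK => /eqP rr.
have -> : r = 0 by nra.
rewrite mulr0 normr_le0 raddfN oppr_eq0/= => /eqP tre.
by move/eqP: e0; apply; exact: idempotent_trace_eq0.
Qed.

(** Two-sided ideals of the semiring, taken to be closed cones so that the minimal rank argument
    runs inside them. The induction on ideals serves the case [I = K]. *)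
Definition ideal (I : set 'M[R]_n.+1) : Prop :=
  [/\ closed I, cone I, I `<=` K &
      forall X Y, I X -> K Y -> I (X * Y) /\ I (Y * X)].

(* Factor a non-nilpotent A in I of minimal rank l as C D. The elements of I of the
   form C B D' with D' C = 1 are parametrised by a cone of l x l matrices B, whose
   nonzero elements are invertible since l is minimal. *)
Lemma primitive_idempotent I : ideal I -> (exists2 X, I X & X != 0) ->
  exists2 P, I P /\ P != 0 & P * P = P /\
    forall Y, K Y -> exists c, P * Y * P = c *: P.
Proof.
move=> [Icl cI IK IM] [X0 IX0 X00].
pose p d := `[< exists2 X, I X & X != 0 /\ \rank X = d >].
have [|l /asboolP[X IX [Xn0 rX]] lmin] := @ex_minnP p.
  by exists (\rank X0); apply/asboolP; exists X0.
have {}lmin Y : I Y -> Y != 0 -> (l <= \rank Y)%N.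
  by move=> IY Y0; apply: lmin; apply/asboolP; exists Y.
have [Y KY trXY] : exists2 Y, K Y & \tr (X * Y) != 0.
  apply: contrapT => nY; move/eqP: Xn0; apply; apply: Knd => [|Y KY]; first exact: IK.
  by apply/eqP; apply: contrapT => /negP h; apply: nY; exists Y.
pose A := X * Y.
have IA : I A by case: (IM _ _ IX KY).
have A0 : A != 0 by apply: contra_neq trXY => h; rewrite -/A h mxtrace0.
have rA : \rank A = l.
  by apply/eqP; rewrite eqn_leq lmin// andbT -rX mxrankM_maxl.
have [C [D [AE [L LC] [S DS]]]] : exists C : 'M[R]_(n.+1, l),
  exists D : 'M[R]_(l, n.+1),
    [/\ C *m D = A, exists L, L *m C = 1%:M & exists S, D *m S = 1%:M].
  rewrite -rA; exists (col_base A), (row_base A); split; first exact: mulmx_base.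
    by have [L] := row_fullP (col_base_full A); exists L.
  by have [S] := row_freeP (row_base_free A); exists S.
have CKD (B : 'M[R]_l) : L *m (C *m B *m D) *m S = B.
  by rewrite -!mulmxA DS mulmx1 mulmxA LC mul1mx.
(* A nonzero trace excludes [A * A = 0], so [A * A] still has rank [l], and [D *m C] must have full
   rank. *)
have uDC : D *m C \in unitmx.
  have IAA : I (A * A) by case: (IM _ _ IA (IK _ IA)).
  have AA0 : A * A != 0.
    apply: contra_neq trXY => h.
    by rewrite -/A (@mxtrace_scaled_idem _ _ A 0) ?mul0r// scale0r.
  rewrite -row_free_unit -row_leq_rank (leq_trans (lmin _ IAA AA0))//.
  by rewrite -AE -mulmxE mulmxA -(mulmxA C) (leq_trans (mxrankM_maxl _ _))//
    mxrankM_maxr.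
have [D' [D'C D'S DE]] : exists D' : 'M[R]_(l, n.+1), [/\ D' *m C = 1%:M,
    D' *m (S *m (D *m C)) = 1%:M & D *m C *m D' = D].
  exists (invmx (D *m C) *m D); split; last exact: mulKVmx.
    by rewrite -mulmxA mulVmx.
  by rewrite -mulmxA (mulmxA D) DS mul1mx mulVmx.
pose T : set 'M[R]_l := [set B | I (C *m B *m D')].
have CKD' (B : 'M[R]_l) : L *m (C *m B *m D') *m (S *m (D *m C)) = B.
  by rewrite -!mulmxA D'S mulmx1 mulmxA LC mul1mx.
have [I0 ID IZ] := cI.
have [|||||||T1 Tsc] := @division_cone_scalar _ l T _ _ _ _ _ (D *m C).
- apply: preimage_closed => // B _; apply: (@cvg_mulmx _ _ (nbhs B));
  last exact: cvg_cst.
  by apply: (@cvg_mulmx _ _ (nbhs B)); [exact: cvg_cst|exact: cvg_id].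
- split; first by rewrite /T/= mulmx0 mul0mx.
    by move=> B1 B2 TB1 TB2; rewrite /T/= mulmxDr mulmxDl; exact: ID.
  by move=> c B c0 TB; rewrite /T/= -scalemxAr -scalemxAl; exact: IZ.
- move=> B TB TNB; rewrite -(CKD' B).
  have -> : C *m B *m D' = 0.
    by apply: semiring_sharp; apply: IK => //; rewrite -mulNmx -mulmxN.
  by rewrite mulmx0 mul0mx.
- move=> B1 B2 TB1 TB2; have [+ _] := IM _ _ TB1 (IK _ TB2).
  suff -> : C *m B1 *m D' * (C *m B2 *m D') = C *m (B1 *m B2) *m D' by [].
  by rewrite -mulmxE !mulmxA -(mulmxA (C *m B1) D' C) D'C mulmx1.
- move=> B TB B0; rewrite -row_free_unit -row_leq_rank.
  have CB0 : C *m B *m D' != 0.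
    by apply: contra_neq B0 => h; rewrite -(CKD' B) h mulmx0 mul0mx.
  rewrite (leq_trans (lmin _ TB CB0))//.
  by rewrite (leq_trans (mxrankM_maxl _ _))// mxrankM_maxr.
- by rewrite /T/= -mulmxA DE AE.
- apply: contra_neq A0 => h; rewrite -AE.
  have <- : C *m (D *m C) *m D' = C *m D by rewrite -mulmxA DE.
  by rewrite h mulmx0 mul0mx.
move: T1; rewrite /T/= mulmx1 => IP.
have PE : (C *m D') *m A = A by rewrite -AE mulmxA -(mulmxA C) D'C mulmx1.
exists (C *m D'); split=> //.
- by apply: contra_neq A0 => h; rewrite -PE h mul0mx.
- by rewrite -mulmxE mulmxA -(mulmxA C) D'C mulmx1.
move=> Y' KY'; have [IPY _] := IM _ _ IP KY'.
have [IPYP _] := IM _ _ IPY (IK _ IP).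
have PYPE : C *m D' * Y' * (C *m D') = C *m (D' *m Y' *m C) *m D'.
  by rewrite -!mulmxE !mulmxA.
have [c Tc] : exists c, D' *m Y' *m C = c%:M by apply: Tsc; rewrite /T/= -PYPE.
by exists c; rewrite PYPE Tc mul_mx_scalar scalemxAl.
Qed.

(* By induction on the dimension of the span of I: the elements of I which annihilate
   the left ideal of a primitive idempotent P form a smaller ideal J; to a vector for
   J, add Y0 v1 with v1 in the image of P and Y0 an order unit of K. *)
Lemma separating_vector I : ideal I ->
  exists v : 'cV[R]_n.+1, forall X, K X -> (X *m v = 0 <-> forall Z, I Z -> X * Z = 0).
Proof.
have [Y0 KY0 Y0K] := cone_order_unit cK.
have sK := semiring_sharp.
suff main d : forall I (W : {vspace 'M[R]_n.+1}), ideal I ->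
  (forall X, I X -> X \in W) ->
    (\dim W < d)%N -> exists v : 'cV[R]_n.+1,
    forall X, K X -> (X *m v = 0 <-> forall Z, I Z -> X * Z = 0).
  by move=> idI; apply: (main (\dim {:'M[R]_n.+1}).+1 I fullv) => // X _; exact: memvf.
elim: d {I} => // d IHd I W idI IW dW.
have [[X IX X0]|nI] := pselect (exists2 X, I X & X != 0); last first.
  exists 0 => X KX; rewrite mulmx0; split=> // _ Z IZ.
  have -> : Z = 0 by apply/eqP; apply: contrapT => /negP Z0; apply: nI; exists Z.
  by rewrite mulr0.
have [P [IP P0] [PP PK]] := primitive_idempotent idI (ex_intro2 _ _ X IX X0).
have [Icl cI IK IM] := idI.
have KP := IK _ IP.
pose J : set 'M[R]_n.+1 := I `&` [set Z | forall Y, K Y -> Z * Y * P = 0].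
have idJ : ideal J.
  have [I0 ID IZ] := cI; split.
  - apply: closedI => //.
    have -> : [set Z | forall Y, K Y -> Z * Y * P = 0] =
        \bigcap_(Y in K) ((fun Z => Z *m Y *m P) @^-1` [set 0]) by [].
    apply: closed_bigI => Y _; apply: preimage_closed; last exact: mx_closed1.
    move=> Z _; apply: (@cvg_mulmx _ _ (nbhs Z)); last exact: cvg_cst.
    by apply: (@cvg_mulmx _ _ (nbhs Z)); [exact: cvg_id|exact: cvg_cst].
  - split; first by split=> // Y KY /=; rewrite !mul0r.
      move=> Z1 Z2 [IZ1 Z1P] [IZ2 Z2P]; split; first exact: ID.
      by move=> Y KY /=; rewrite !mulrDl Z1P// Z2P// addr0.
    move=> c Z c0 [IZc ZP]; split; first exact: IZ.
    by move=> Y KY /=; rewrite -!scalerAl ZP// scaler0.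
  - by move=> Z [/IK].
  - move=> Z Y [IZc ZP] KY; have [IZY IYZ] := IM _ _ IZc KY; split; split=> //=.
      by move=> Y' KY'; rewrite -(mulrA Z) ZP//; exact: KM.
    by move=> Y' KY'; rewrite -!mulrA (mulrA Z) ZP// mulr0.
pose f := linfun (mulmxr P : 'M[R]_n.+1 -> 'M[R]_n.+1).
have fE Z : f Z = Z *m P by rewrite lfunE.
have [Z JZ||v' v'P] := IHd J (W :&: lker f)%VS idJ.
- rewrite memv_cap IW; last by case: JZ.
  have [_ /(_ 1 K1)] := JZ; rewrite mulr1 => ZP.
  by rewrite memv_ker fE mulmxE ZP eqxx.
- apply: leq_trans (dW : (\dim W <= d)%N); rewrite ltnNge; apply/negP => dWJ.
  have /eqP WE : (W :&: lker f)%VS == W by rewrite eqEdim capvSl.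
  have : P \in (W :&: lker f)%VS by rewrite WE IW.
  by rewrite memv_cap memv_ker fE mulmxE PP (negbTE P0) andbF.
have [v1 v10 Pv1] : exists2 v1 : 'cV[R]_n.+1, v1 != 0 & P *m v1 = v1.
  have [j Pj] : exists j, col j P != 0.
    apply/existsP; apply: contraT => /existsPn h; case/eqP: P0.
    apply/matrixP => i j; have /negPn/eqP/matrixP/(_ i 0) := h j.
    by rewrite !mxE.
  exists (col j P) => //; apply/matrixP => i k; rewrite mxE [RHS]mxE.
  transitivity ((P *m P) i j); last by rewrite mulmxE PP.
  by rewrite mxE; apply: eq_bigr => m _; rewrite mxE.
(* Nondegeneracy makes [K] semiprime: here every [U * Y] is square-zero, hence traceless. *)
have square0 U : K U -> (forall Y, K Y -> U * Y * U = 0) -> U = 0.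
  move=> KU UKU; apply: Knd => // Y KY.
  by apply: (@mxtrace_nilpotent 2); rewrite expr2 mulrA UKU// mul0r.
(* For [Z] in [K], [P * (Z * (X' * Y0)) * P] is a multiple of [P] which kills [v1], so it is zero;
   by nondegeneracy [X' * Y0 * P = 0]. Sharpness extends this from the order unit [Y0] to every
   [Y']. *)
have absorb X' Y' : K X' -> K Y' -> X' *m (Y0 *m v1) = 0 -> X' * Y' * P = 0.
  move=> KX KY XYv.
  have XYP : X' * Y0 * P = 0.
    apply: Knd => [|Z KZZ]; first exact: KM (KM KX KY0) KP.
    have [c cP] := PK _ (KM KZZ (KM KX KY0)).
    have c0 : c = 0.
      have : (P * (Z * (X' * Y0)) * P) *m v1 = 0.
        by rewrite -!mulmxE -!mulmxA Pv1 XYv !mulmx0.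
      rewrite cP -scalemxAl Pv1 => /eqP; rewrite scaler_eq0 (negbTE v10) orbF.
      by move=> /eqP.
    have -> : \tr (X' * Y0 * P * Z) = \tr (P * (Z * (X' * Y0)) * P).
      rewrite [RHS]mxtrace_mulC !mulmxE [P * (P * _)]mulrA PP [P * (Z * _)]mulrA.
      by rewrite [RHS]mxtrace_mulC mulmxE [RHS]/= mulrA.
    by rewrite cP c0 scale0r mxtrace0.
  have [c c0 KcY] := Y0K _ KY.
  apply: sK; first exact: KM (KM KX KY) KP.
  have -> : - (X' * Y' * P) = X' * (c *: Y0 - Y') * P.
    by rewrite mulrBr mulrBl -scalerAr -scalerAl XYP scaler0 sub0r.
  exact: KM (KM KX KcY) KP.
have [_ _ JK JM] := idJ.
exists (Y0 *m v1 + v') => X' KX; split=> [|XI]; last first.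
  rewrite mulmxDr; have -> : X' *m v' = 0.
    by apply/(v'P _ KX) => Z [/XI].
  have /XI : I (Y0 * P) by case: (IM _ _ IP KY0).
  rewrite -!mulmxE mulmxA => h.
  by rewrite addr0 -{1}Pv1 2!mulmxA h mul0mx.
rewrite mulmxDr => /eqP; rewrite addr_eq0 => /eqP Xv.
(* [Z] kills [X' *m (Y0 *m v1)], because [v1] is in the image of [P]; hence it kills [X' *m v'], and
   the property of [v'] applies to [Z * X']. *)
have JXJ Z Z' : J Z -> J Z' -> Z * X' * Z' = 0.
  move=> JZ; have KZX : K (Z * X') by apply: KM => //; exact: JK.
  move: Z'; apply/(v'P _ KZX).
  have [_ /(_ _ (KM KX KY0)) ZP] := JZ.
  have : Z *m (X' *m (Y0 *m v1)) = 0.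
    by rewrite -Pv1 3!mulmxA -(mulmxA Z) !mulmxE ZP mul0mx.
  by rewrite Xv mulmxN mulmxA => /eqP; rewrite oppr_eq0 => /eqP.
have XJ Z : J Z -> X' * Z = 0.
  move=> JZ; have [_ JXZ] := JM _ _ JZ KX.
  apply: square0; first exact: JK.
  move=> Y KY; rewrite [_ * (X' * Z)]mulrA; apply: JXJ => //.
  by case: (JM _ _ JXZ KY).
have XP Y : K Y -> X' * Y * P = 0.
  move=> KY; apply: absorb => //.
  suff h : X' *m v' = 0 by rewrite Xv h oppr0.
  exact/(v'P _ KX).
move=> Z IZ; have [_ IXZ] := IM _ _ IZ KX.
have JXZ : J (X' * Z).
  by split=> // Y KY /=; rewrite -(mulrA X'); apply: XP; apply: KM => //; exact: IK.
apply: square0; first exact: JK.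
move=> Y KY; rewrite -!mulrA; apply: XJ.
have [_ +] := JM _ _ JXZ (KM (IK _ IZ) KY).
by rewrite -mulrA.
Qed.

End MatrixSemiring.

(** * An invariant cone in the space of vectors *)

Section InvariantCone.
Variable R : realType.

Lemma closure_cone m n (C : set 'M[R]_(m, n)) : cone C -> cone (closure C).
Proof.
move=> [C0 CD CZ]; split; first exact: subset_closure.
- move=> x y Cx Cy.
  have h1 z : C z -> closure C (x + z).
    move=> Cz; have sc : C `<=` (fun w => w + z) @^-1` closure C.
      by move=> w Cw; apply: subset_closure; exact: CD.
    have cl : closed ((fun w => w + z) @^-1` closure C).
      apply: preimage_closed; last exact: closed_closure.
      by move=> w _; apply: (@cvgD _ _ _ (nbhs w)); [exact: cvg_id|exact: cvg_cst].
    exact: (closure_subset_closed cl sc).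
  have cl : closed ((fun w => x + w) @^-1` closure C).
    apply: preimage_closed; last exact: closed_closure.
    by move=> w _; apply: (@cvgD _ _ _ (nbhs w)); [exact: cvg_cst|exact: cvg_id].
  exact: (closure_subset_closed cl h1).
- move=> c x c0; move: x.
  have cl : closed ((fun w => c *: w) @^-1` closure C).
    apply: preimage_closed; last exact: closed_closure.
    by move=> w _; apply: (@cvgZ _ _ _ (nbhs w)); [exact: cvg_cst|exact: cvg_id].
  by apply: (closure_subset_closed cl) => x Cx; apply: subset_closure; exact: CZ.
Qed.

Lemma closure_mulmx m n p (X : 'M[R]_(m, n)) (A : set 'M[R]_(n, p))
  (B : set 'M[R]_(m, p)) :
  (forall x, A x -> B (X *m x)) -> forall x, closure A x -> closure B (X *m x).
Proof.
move=> AB.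
have cl : closed ((fun w => X *m w) @^-1` closure B).
  apply: preimage_closed; last exact: closed_closure.
  by move=> w _; exact: mulmx_continuous.
by apply: (closure_subset_closed cl) => x Ax; apply: subset_closure; exact: AB.
Qed.

Variables (n : nat) (K : set 'M[R]_n.+1).
Hypotheses (Kcl : closed K) (cK : cone K) (K1 : K 1) (sK : sharp K).
Hypothesis KM : forall X Y, K X -> K Y -> K (X * Y).

Variable v : 'cV[R]_n.+1.
Hypothesis Kv : forall X, K X -> X *m v = 0 -> X = 0.

Let KZ c X : 0 <= c -> K X -> K (c *: X). Proof. by case: cK => _ _; apply. Qed.
Let KD X Y : K X -> K Y -> K (X + Y). Proof. by case: cK => _ KD _; apply: KD. Qed.

(* [orbit_cone e X x]: x is a sum of terms X_i (v + b_i) with X_i in K of sum X and b_i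
   of norm at most e. *)
Inductive orbit_cone (e : R) : 'M[R]_n.+1 -> 'cV[R]_n.+1 -> Prop :=
| orbit_cone_gen X b : K X -> `|b| <= e -> orbit_cone e X (X *m (v + b))
| orbit_coneD X x Y y : orbit_cone e X x -> orbit_cone e Y y ->
  orbit_cone e (X + Y) (x + y).

Lemma dot_le_norm m p : exists2 c : R, 0 <= c & forall x y : 'M[R]_(m, p),
  dot x y <= c * `|x| * `|y|.
Proof.
exists (p%:R * m%:R); first by rewrite mulr_ge0.
move=> x y; rewrite dotE -!mulrA mulr_natl -[X in _ *+ X]card_ord -sumr_const.
apply: ler_sum => i _; rewrite mulr_natl -[X in _ *+ X]card_ord -sumr_const.
apply: ler_sum => j _; rewrite (le_trans (ler_norm _))// normrM.
by apply: ler_pM => //; exact: entry_le_norm.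
Qed.

(** Replacing [v] by a ball could destroy sharpness. The sum [X] of the coefficients is carried
    along to control this: the deviation from [X *m v] is at most [h * dot w X], a bound additive in
    [X], while [X *m v] has norm at least [d] times that of [X]. The set [D1] of vectors so
    controlled is closed and contains no two nonzero opposite vectors. *)
Lemma invariant_cone : exists C : set 'cV[R]_n.+1,
  [/\ closed C, cone C, sharp C, exists u, interior_point C u &
      forall X x, K X -> C x -> C (X *m x)].
Proof.
have [w wK] := positive_functional Kcl cK sK.
have [c c0 cw] : exists2 c, 0 < c & forall X, K X -> c * `|X| <= dot w X.
  apply: cone_lower_bound => //; [exact: dot_continuous|by move=> *; rewrite dotZr].
have [d d0 dv] : exists2 d, 0 < d & forall X, K X -> d * `|X| <= `|X *m v|.
  apply: cone_lower_bound => //.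
  - move=> X; apply: (@cvg_norm _ _ _ (nbhs X)); apply: (@cvg_mulmx _ _ (nbhs X));
    [exact: cvg_id|exact: cvg_cst].
  - by move=> a X a0; rewrite -scalemxAl normrZ ger0_norm.
  - by move=> X KX; rewrite normr_gt0; apply: contra_neq; exact: Kv.
have [c1 c10 c1P] := dot_le_norm n.+1 n.+1.
pose C1 := c1 * `|w| + 1.
have C1_gt0 : 0 < C1 by rewrite ltr_wpDl// mulr_ge0.
have wC X : dot w X <= C1 * `|X|.
  by rewrite (le_trans (c1P _ _))// ler_wpM2r// lerDl.
(* With this [h] the deviation is at most half the lower bound for [X *m v]. Below, [e] is fitted to
   [N * e = h * c], where [N] is the factor in [mulmx_norm_le]. *)
pose h := d / C1 / 2.
have h0 : 0 < h by rewrite !divr_gt0.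
have hC : h * C1 = d / 2 by rewrite /h mulrAC divfK// gt_eqF.
pose N : R := n.+1%:R.
have N0 : 0 < N by rewrite ltr0n.
pose e := h * c / N.
have e0 : 0 < e by rewrite divr_gt0// mulr_gt0.
pose D1 : set 'cV[R]_n.+1 := [set x | exists2 X, K X & `|x - X *m v| <= h * dot w X].
have DK X x : orbit_cone e X x -> K X /\ `|x - X *m v| <= h * dot w X.
  elim=> {X x} [X b KX be|X x Y y _ [KX hX] _ [KY hY]].
    split=> //; rewrite mulmxDr addrAC subrr add0r (le_trans (mulmx_norm_le _ _))//.
    have := cw _ KX; have := normr_ge0 X.
    have eN : N * e = h * c by rewrite /e mulrC divfK ?gt_eqF.
    have : N * (`|X| * `|b|) <= N * (`|X| * e) by rewrite ler_pM2l// ler_wpM2l.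
    rewrite -/N (mulrC `|X| e) [X in _ <= X]mulrA eN. nra.
  split; first exact: KD.
  by rewrite mulmxDl opprD addrACA (le_trans (ler_normD _ _))// dotDr mulrDr lerD.
pose D : set 'cV[R]_n.+1 := [set x | exists X, orbit_cone e X x].
have cD : cone D.
  split.
  - exists 0; have [K0 _ _] := cK; have := @orbit_cone_gen e 0 0 K0.
    by rewrite mul0mx normr0 => /(_ (ltW e0)).
  - by move=> x y [X Xx] [Y Yy]; exists (X + Y); exact: orbit_coneD.
  - move=> a x a0 [X Xx]; exists (a *: X); elim: Xx =>
    {X x} [X b KX be|X x Y y _ IHx _ IHy].
      by rewrite scalemxAl; apply: orbit_cone_gen => //; exact: KZ.
    by rewrite !scalerDr; exact: orbit_coneD.
have DM X x : K X -> D x -> D (X *m x).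
  move=> KX [Y Yx]; exists (X * Y); elim: Yx => {Y x} [Y b KY be|Y y Z z _ IHy _ IHz].
    by rewrite mulmxA; apply: orbit_cone_gen => //; exact: KM.
  by rewrite mulmxDr mulrDr; exact: orbit_coneD.
have DD1 : D `<=` D1 by move=> x [X /DK[KX hX]]; exists X.
have D1cl : closed D1.
  apply: closed_ultra => F x FU Fx FD.
  have [Xf XfP] : {Xf : 'cV[R]_n.+1 -> 'M[R]_n.+1 & forall y, D1 y ->
      K (Xf y) /\ `|y - Xf y *m v| <= h * dot w (Xf y)}.
    apply: (@choice _ _ (fun y X => D1 y -> K X /\ `|y - X *m v| <= h * dot w X)) => y.
    by have [[X KX hX]|nD] := pselect (D1 y); [exists X|exists 0].
  have Xb : \forall y \near F, `|Xf y| <= 2 / d * (`|x| + 1).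
    have : \forall y \near F, `|y| <= `|x| + 1.
      have /cvgr_norm_le := (Fx : id @ F --> x); apply; rewrite ltrDl//.
    apply: filterS2 FD => y /XfP[KX hX] yx.
    rewrite mulrAC ler_pdivlMr// mulrC.
    have := dv _ KX; have := wC (Xf y).
    have : `|Xf y *m v| <= `|y| + `|y - Xf y *m v|.
      rewrite -{1}[Xf y *m v](subKr y) (le_trans (ler_normB _ _))//.
    have : h * dot w (Xf y) <= h * (C1 * `|Xf y|) by rewrite ler_pM2l.
    rewrite mulrA hC. lra.
  have [X FX] := ultra_bounded FU Xb.
  have KFX : \forall y \near F, K (Xf y) by apply: filterS FD => y /XfP[].
  exists X; first exact: (closed_cvg _ Kcl KFX).
  have lc : (fun y => h * dot w (Xf y) - `|y - Xf y *m v|) @ F -->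
    h * dot w X - `|x - X *m v|.
    apply: cvgB.
      by apply: cvgM; [exact: cvg_cst|apply: cvg_dot => //; exact: cvg_cst].
    by apply: cvg_norm; apply: cvgB => //; apply: cvg_mulmx => //; exact: cvg_cst.
  rewrite -subr_ge0; apply: (closed_cvg _ (@closed_ge _ 0) _ _ lc).
  by apply: filterS FD => y /XfP[_ /=]; rewrite subr_ge0.
have D1s x : D1 x -> D1 (- x) -> x = 0.
  move=> [X KX hX] [Y KY hY].
  have KXY := KD KX KY.
  have : `|(X + Y) *m v| <= h * dot w (X + Y).
    rewrite -normrN mulmxDl (_ : - _ = (x - X *m v) + (- x - Y *m v)).
      by rewrite (le_trans (ler_normD _ _))// dotDr mulrDr lerD.
    by rewrite addrACA subrr add0r opprD.
  have := dv _ KXY.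
  have : h * dot w (X + Y) <= h * (C1 * `|X + Y|) by rewrite ler_pM2l.
  rewrite mulrA hC => h1 h2 h3.
  have XY0 : `|X + Y| <= 0 by nra.
  have X0 : X = 0.
    by apply: (sharpD sK KX KY); apply/eqP; rewrite -normr_le0.
  by move: hX; rewrite X0 mul0mx subr0 dot0r mulr0 normr_le0 => /eqP.
exists (closure D); split.
- exact: closed_closure.
- exact: closure_cone.
- have clD : closure D `<=` D1 by exact: closure_subset_closed.
  by move=> x /clD Dx /clD; exact: D1s.
- exists v, e => // z ze; apply: subset_closure; exists 1.
  have := @orbit_cone_gen e 1 z K1 ze; by rewrite mul1mx.
- by move=> X x KX; apply: closure_mulmx => y; exact: DM.
Qed.

End InvariantCone.

(** * Lifts from PGL to matrices *)

Section Lifts.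
Variables (R : realType) (n : nat).
Implicit Types (A : GL R n) (p q : PGL R n) (M : 'M[R]_n.+1).

Definition lifts M p : Prop := exists2 A : GL R n, val A = M & \pi_(PGL R n) A = p.

(** The absolute value is unavoidable: in even size, scaling does not change the sign of the
    determinant. *)
Definition nlifts M p : Prop := lifts M p /\ `|\det M| = 1.

Lemma lifts_unit M p : lifts M p -> M \in unitmx.
Proof. by case=> A <- _; exact: Defs.GL_unit. Qed.

Lemma lifts_pi M : M \in unitmx -> exists p, lifts M p.
Proof.
move=> uM; have AM : M \in GL R n by apply: mem_set.
pose A : GL R n := exist (fun M => M \in GL R n) M AM; by exists (\pi_(PGL R n) A), A.
Qed.

Lemma lifts_inj M p q : lifts M p -> lifts M q -> p = q.
Proof. by move=> [A AM <-] [B BM <-]; congr (\pi_(PGL R n) _); apply: val_inj;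
  rewrite AM BM. Qed.

Lemma lifts_scale M p (c : R) : c != 0 -> lifts M p -> lifts (c *: M) p.
Proof.
move=> c0 [A <- <-]; have AM : c *: val A \in GL R n.
  by apply: mem_set; rewrite /GL/= unitmxZ ?unitfE// Defs.GL_unit.
pose B : GL R n := exist (fun M => M \in GL R n) (c *: val A) AM.
by exists B => //; apply/PGL_eqP; exists c.
Qed.

Lemma lifts_proportional M N p : lifts M p -> lifts N p -> exists2 c, c != 0 & M =
  c *: N.
Proof. by move=> [A <- <-] [B <- /esym/PGL_eqP[c c0 h]]; exists c. Qed.

Lemma lifts_mul M N p q : lifts M p -> lifts N q -> lifts (M *m N) (p * q)%g.
Proof.
move=> [A <- <-] [B <- <-]; exists (GLmul A B) => //.
by rewrite -[RHS]/(PGLmul _ _) PGLmulE.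
Qed.

Lemma lifts_inv M p : lifts M p -> lifts (invmx M) (p^-1)%g.
Proof.
move=> [A <- <-]; exists (GLinv A) => //.
by rewrite -[RHS]/(PGLinv _) PGLinvE.
Qed.

Lemma nlifts_ex p : exists M, nlifts M p.
Proof.
pose A := repr p.
have d0 : 0 < `|\det (val A)| by rewrite normr_gt0 -unitfE -unitmxE Defs.GL_unit.
(* The power [-1/(n+1)] of the absolute value of the determinant. *)
pose c : R := expR (- (n.+1%:R^-1 * ln `|\det (val A)|)).
have c0 : 0 < c by exact: expR_gt0.
exists (c *: val A); split.
  by apply: lifts_scale; [rewrite gt_eqF|exists A => //; rewrite reprK].
rewrite detZ normrM normrX gtr0_norm// -expRM_natl mulrN mulrA divff ?pnatr_eq0// mul1r.
by rewrite expRN lnK// mulVf// gt_eqF.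
Qed.

(* Lifts of determinant 1 or -1 are defined up to sign, but the products of two of their
   entries are well-defined continuous functions on PGL. *)
Definition lift_product i j k l M : R :=
  M i j * M k l * expR (- (2 / n.+1%:R * ln `|\det M|)).

Lemma lift_productZ i j k l (c : R) M : c != 0 -> M \in unitmx ->
  lift_product i j k l (c *: M) = lift_product i j k l M.
Proof.
move=> c0 uM; have d0 : 0 < `|\det M| by rewrite normr_gt0 -unitfE -unitmxE.
have c0' : 0 < `|c| by rewrite normr_gt0.
rewrite /lift_product !mxE detZ normrM normrX lnM ?posrE ?exprn_gt0// lnXn//.
rewrite mulrDr -[ln `|c| *+ _]mulr_natl (mulrA (2 / _)) divfK ?pnatr_eq0// opprD expRD.
rewrite expRN expRM_natl lnK ?posrE// real_normK ?num_real//.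
by rewrite (mulrACA c) -expr2 (mulrACA (c ^+ 2)) divff ?expf_neq0// mul1r.
Qed.

Lemma cvg_lift_product T (F : set_system T) {FF : Filter F} (f : T -> 'M[R]_n.+1) M i j
  k l :
  M \in unitmx -> f @ F --> M ->
  (fun t => lift_product i j k l (f t)) @ F --> lift_product i j k l M.
Proof.
move=> uM fM; have d0 : 0 < `|\det M| by rewrite normr_gt0 -unitfE -unitmxE.
move/cvg_mxP: (fM) => fij.
apply: cvgM; first by apply: cvgM.
apply: continuous_cvg; first exact: continuous_expR.
apply: cvgN; apply: cvgM; first exact: cvg_cst.
apply: continuous_cvg; first exact: continuous_ln.
by apply: cvg_norm; exact: cvg_det.
Qed.

Lemma lift_product_continuous i j k l :
  exists h : PGL R n -> R, continuous h /\
    forall M p, lifts M p -> h p = lift_product i j k l M.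
Proof.
exists (fun p => lift_product i j k l (val (repr p))); split; last first.
  move=> M p [A <- <-]; have [c c0 ->] := PGL_reprP A.
  by rewrite lift_productZ// Defs.GL_unit.
apply/(@quotient_continuous (GL R n) _ R^o).
have -> : ((fun p : PGL R n => lift_product i j k l (val (repr p))) \o \pi_(PGL R n)) =
   (fun A : GL R n => lift_product i j k l (val A)).
  apply/funext => A /=; have [c c0 ->] := PGL_reprP A.
  by rewrite lift_productZ// Defs.GL_unit.
move=> A; apply: (@cvg_lift_product _ (nbhs A)); first exact: Defs.GL_unit.
exact: initial_continuous.
Qed.

Lemma lift_product_normed M i j k l : `|\det M| = 1 -> lift_product i j k l M =
  M i j * M k l.
Proof. by rewrite /lift_product => ->; rewrite ln1 mulr0 oppr0 expR0 mulr1. Qed.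

(** The products of two entries of [t x] converge to those of [q]. They bound [t x], which thus has
    a limit [S] along the ultrafilter, with the same products as [q]; a nonzero entry of [q] then
    decides between [S = q] and [S = - q]. *)
Lemma cvg_lift_pm T (F : set_system T) (FU : UltraFilter F) (tau : T -> PGL R n)
  (eta : PGL R n)
    (t : T -> 'M[R]_n.+1) (q : 'M[R]_n.+1) : tau @ F --> eta -> nlifts q eta ->
  (\forall x \near F, nlifts (t x) (tau x)) -> t @ F --> q \/ t @ F --> - q.
Proof.
move=> te [lq dq] tl.
have tq i j k l : (fun x => t x i j * t x k l) @ F --> q i j * q k l.
  have [h [hc hE]] := lift_product_continuous i j k l.
  have ht : (fun x => h (tau x)) @ F --> h eta by apply: continuous_cvg => //;
    exact: hc.
  rewrite (hE _ _ lq) lift_product_normed// in ht.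
  apply: cvg_trans ht; apply: near_eq_cvg; apply: filterS tl => x [lx dx].
  by rewrite (hE _ _ lx) lift_product_normed.
have tb : \forall x \near F, `|t x| <= `|q| ^+ 2 + 2.
  have : \forall x \near F, forall i j, `|t x i j| <= `|q| ^+ 2 + 2.
    apply: filter_forall => i; apply: filter_forall => j.
    have /cvgr_norm_le := tq i j i j => /(_ (`|q| ^+ 2 + 1)) H.
    have {}H : \forall x \near F, `|t x i j * t x i j| <= `|q| ^+ 2 + 1.
      apply: H; rewrite -expr2 normrX ltr_pwDr//.
      by rewrite lerXn2r ?nnegrE ?entry_le_norm.
    apply: filterS H => x; rewrite normrM.
    have := normr_ge0 (t x i j); nra.
  apply: filterS => x tx; rewrite [leLHS]/normr/= mx_normrE; apply: bigmax_le =>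
    [|[i j] _].
    by rewrite addr_ge0// exprn_ge0.
  exact: tx.
have [S tS] := ultra_bounded FU tb.
have Sq i j k l : S i j * S k l = q i j * q k l.
  apply: (@cvg_unique _ (@norm_hausdorff _ R^o) ((fun x => t x i j * t x k l) @ F)) =>
    //=.
  by move/cvg_mxP: tS => tS; apply: cvgM.
have [i [j qij]] : exists i j, q i j != 0.
  apply: contrapT => nq; have q0 : q = 0.
    apply/matrixP => i j; rewrite mxE; apply/eqP; apply: contrapT => /negP qij.
    by apply: nq; exists i, j.
  by move: dq; rewrite q0 det0 normr0 => /esym/eqP; rewrite oner_eq0.
have /eqP := Sq i j i j; rewrite -!expr2 eqf_sqr => /orP[]/eqP Sij.
  left; suff <- : S = q by [].
  by apply/matrixP => k l; apply: (mulfI qij); rewrite -[RHS]Sq Sij.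
right; suff <- : S = - q by [].
apply/matrixP => k l; apply: (mulfI qij); rewrite mxE mulrN -Sq Sij mulNr opprK//.
Qed.

Lemma cvg_pi T (F : set_system T) {FF : Filter F} (t : T -> 'M[R]_n.+1)
    (q : 'M[R]_n.+1)
    (tau : T -> PGL R n) (eta : PGL R n) :
  t @ F --> q -> (forall x, lifts (t x) (tau x)) -> lifts q eta -> tau @ F --> eta.
Proof.
move=> tq lt [A Aq <-].
have [B BP] : {B : T -> GL R n & forall x, val (B x) = t x /\ \pi_(PGL R n) (B x) =
  tau x}.
  apply: (@choice _ _ (fun x (B : GL R n) => val B = t x /\ \pi_(PGL R n) B = tau x)) => x.
  by have [B ? ?] := lt x; exists B.
have BA : B @ F --> A.
  move=> U [D [[V oV <-] VA] VU]; rewrite nbhs_simpl/=.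
  have /tq : nbhs q V by rewrite -Aq; apply: open_nbhs_nbhs.
  rewrite !nbhs_simpl/=; apply: filterS => x Vx; apply: VU.
  suff : V (val (B x)) by []. 
  by have [-> _] := BP x.
have : (fun x => \pi_(PGL R n) (B x)) @ F --> \pi_(PGL R n) A.
  by move=> U /(@pi_continuous _ _ A) /BA.
by have -> : (fun x => \pi_(PGL R n) (B x)) = tau by apply/funext => x; case: (BP x).
Qed.

End Lifts.

(** * Positive words in the lifts and the closed saturated set of positive representations *)

Section PositiveWords.
Variables (R : realType) (G : Type).

(* Noncommutative polynomials without constant term and with nonnegative coefficients:
   [eval] uses the absolute value of the scalars. *)
Inductive word : Type :=
| Letter of G
| Sum of word & word
| Product of word & word
| Scale of R & word.

Fixpoint eval n (r : G -> 'M[R]_n) (w : word) : 'M[R]_n :=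
  match w with
  | Letter g => r g
  | Sum u v => eval r u + eval r v
  | Product u v => eval r u *m eval r v
  | Scale c u => `|c| *: eval r u
  end.

Lemma cvg_eval T (F : set_system T) {FF : Filter F} n (r : T -> G -> 'M[R]_n)
  (s : G -> 'M[R]_n) :
  (forall g, (fun t => r t g) @ F --> s g) ->
  forall w, (fun t => eval (r t) w) @ F --> eval s w.
Proof.
move=> rs; elim=> [g|u IHu v IHv|u IHu v IHv|c u IHu] /=; first exact: rs.
- exact: cvgD.
- exact: cvg_mulmx.
- by apply: cvgZ => //; exact: cvg_cst.
Qed.

Lemma eval_conj n (r : G -> 'M[R]_n) P w : P \in unitmx ->
  eval (fun g => P *m r g *m invmx P) w = P *m eval r w *m invmx P.
Proof.
move=> uP; elim: w => [g|u IHu v IHv|u IHu v IHv|c u IHu] //=.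
- by rewrite IHu IHv mulmxDr mulmxDl.
- by rewrite IHu IHv !mulmxA mulmxKV.
- by rewrite IHu -scalemxAr -scalemxAl.
Qed.

End PositiveWords.

Section PositiveReps.
Variables (R : realType) (n : nat) (G : groupType).
Local Notation Hom := (HomPGL R n G).
Implicit Types (rho sigma tau eta : Hom).

Definition rep_lift (r : G -> 'M[R]_n.+1) rho : Prop :=
  forall g, nlifts (r g) (rep_fun rho g).

(** The choice of signs is part of the existential. It is not asked to be multiplicative: a product
    of lifts is a word distinct from the lift of the product. *)
Definition positive_rep : set Hom :=
  [set rho | exists2 r, rep_lift r rho & forall w, PF (eval r w)].

Lemma rep_fun_continuous g : continuous (fun rho => rep_fun rho g).
Proof.
move=> rho; have c1 : (val : Hom -> {ptws G -> PGL R n}) @ rho -->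
  val rho by exact: initial_continuous.
move/cvg_sup: c1 => /(_ (fmap_filter _ _) g) c1 U; rewrite nbhsE => -[W [oW Wr] WU].
have {}c1 := c1 (nbhs_filter rho) ((fun f : {ptws G -> PGL R n} => f g) @^-1` U).
apply: c1; exists ((fun f : {ptws G -> PGL R n} => f g) @^-1` W); split=> //.
  by exists W.
by move=> f /= Wf; apply: WU.
Qed.

Lemma cvg_rep T (F : set_system T) {FF : Filter F} (f : T -> Hom) rho :
  (forall g, (fun t => rep_fun (f t) g) @ F --> rep_fun rho g) -> f @ F --> rho.
Proof.
move=> fg.
have h : (fun t => val (f t)) @ F --> (val rho : {ptws G -> PGL R n}).
  apply/cvg_sup => g U [B [[W oW <-] Wr] WU] /=.
  rewrite nbhs_simpl/=; have := fg g W (open_nbhs_nbhs (conj oW Wr)).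
  rewrite !nbhs_simpl/=.
  by apply: filterS => t Wt; apply: WU.
move=> U [B [[W oW <-] Wr] WU]; rewrite nbhs_simpl/=.
have := h W (open_nbhs_nbhs (conj oW Wr)); rewrite nbhs_simpl/=.
by apply: filterS => t Wt; apply: WU.
Qed.

Lemma rep_funM (rho : Hom) g h : rep_fun rho (g * h)%g =
  (rep_fun rho g * rep_fun rho h)%g.
Proof. exact: (set_valP rho). Qed.

Lemma rep_fun1 (rho : Hom) : rep_fun rho 1%g = 1%g.
Proof. by apply: (mulgI (rep_fun rho 1%g)); rewrite -rep_funM !mulg1. Qed.

Lemma rep_lift_ex rho : exists r, rep_lift r rho.
Proof.
have [r rP] : {r : G -> 'M[R]_n.+1 & forall g, nlifts (r g) (rep_fun rho g)}.
  apply: (@choice _ _ (fun g M => nlifts M (rep_fun rho g))) => g; exact: nlifts_ex.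
by exists r.
Qed.

Lemma nlifts_pm (q : 'M[R]_n.+1) p (b : bool) : nlifts q p -> nlifts ((-1) ^+ b *: q) p.
Proof.
move=> [lq dq]; split; first by apply: lifts_scale => //; rewrite signr_eq0.
by rewrite detZ normrM normrX normrX normrN1 !expr1n mul1r.
Qed.

Lemma cvg_lift_sign T (F : set_system T) (FU : UltraFilter F) (tau : T -> PGL R n)
    (eta : PGL R n) (t : T -> 'M[R]_n.+1) (q : 'M[R]_n.+1) :
  tau @ F --> eta -> nlifts q eta ->
  (\forall x \near F, nlifts (t x) (tau x)) -> exists b : bool, t @ F -->
    (-1) ^+ b *: q.
Proof.
move=> te lq lt; have [tq|tq] := cvg_lift_pm FU te lq lt.
  by exists false; rewrite expr0 scale1r.
by exists true; rewrite expr1 scaleN1r.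
Qed.

(** Lifts chosen pointwise, positive wherever possible, converge up to a sign depending on [g];
    absorbing this sign in the lift of the limit makes every word converge. *)
Lemma positive_rep_closed : closed positive_rep.
Proof.
apply: closed_ultra => F eta FU Feta FP.
have [r rP] : {r : Hom -> G -> 'M[R]_n.+1 & forall rho, rep_lift (r rho) rho /\
    (positive_rep rho -> forall w, PF (eval (r rho) w))}.
  apply: (@choice _ _ (fun rho r =>
    rep_lift r rho /\ (positive_rep rho -> forall w, PF (eval r w)))) => rho.
  have [[r lr rw]|nP] := pselect (positive_rep rho); first by exists r.
  by have [r lr] := rep_lift_ex rho; exists r.
have [q lq] := rep_lift_ex eta.
have [b bP] : {b : G -> bool & forall g, (fun rho => r rho g) @ F -->
  (-1) ^+ b g *: q g}.
  apply: (@choice _ _ (fun g (b : bool) => (fun rho => r rho g) @ F -->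
    (-1) ^+ b *: q g)) => g.
  apply: (@cvg_lift_sign _ F FU (fun rho => rep_fun rho g) (rep_fun eta g)) => //.
    by move=> U /(@rep_fun_continuous g eta) /Feta.
  by apply: nearW => rho; case: (rP rho) => + _; apply.
exists (fun g => (-1) ^+ b g *: q g) => [g|w]; first exact: nlifts_pm.
have FF : Filter F by exact: _.
have ev := @cvg_eval R G _ F FF _ r _ bP w.
have evP : \forall rho \near F, PF (eval (r rho) w).
  by apply: filterS FP => rho Prho; case: (rP rho) => _; apply.
exact: (PF_ultra FU ev evP).
Qed.

(* Along an ultrafilter of conjugates of sigma which tends to eta, the signs of the
   lifts stabilise, so sigma has a lift with the traces of a positive lift of eta. *)
Lemma positive_rep_orbit sigma eta :
  closure (conj_orbit sigma) eta -> positive_rep eta -> positive_rep sigma.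
Proof.
rewrite closureEcvg => -[F0 F0F [F0eta F0s]] [q lq qw].
have [F [FU F0F']] := ultraFilterLemma F0F.
have Feta : F --> eta by apply: cvg_trans F0eta.
have Fs : F (conj_orbit sigma) by apply/F0F'/F0s.
have [s ls] := rep_lift_ex sigma.
have [P PP] : {P : Hom -> 'M[R]_n.+1 & forall tau, P tau \in unitmx /\
    (conj_orbit sigma tau -> rep_lift (fun g => P tau *m s g *m invmx (P tau)) tau)}.
  apply: (@choice _ _ (fun tau P => P \in unitmx /\ (conj_orbit sigma tau ->
    rep_lift (fun g => P *m s g *m invmx P) tau))) => tau.
  have [[p tauE]|nP] := pselect (conj_orbit sigma tau); last by exists 1%:M; split;
    rewrite ?unitmx1.
  have [M [lM dM]] := nlifts_ex p; have uM := lifts_unit lM; exists M; split=> // _ g.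
  split.
    rewrite tauE; apply: lifts_mul; last exact: lifts_inv.
    by apply: lifts_mul => //; case: (ls g).
  rewrite !det_mulmx mulrAC -det_mulmx mulmxV// det1 mul1r.
  by case: (ls g).
pose t tau g := P tau *m s g *m invmx (P tau).
have [b bP] : {b : G -> bool & forall g, (fun tau => t tau g) @ F -->
  (-1) ^+ b g *: q g}.
  apply: (@choice _ _ (fun g (b : bool) => (fun tau => t tau g) @ F -->
    (-1) ^+ b *: q g)) => g.
  apply: (@cvg_lift_sign _ F FU (fun rho => rep_fun rho g) (rep_fun eta g)) => //.
    by move=> U /(@rep_fun_continuous g eta) /Feta.
  by apply: filterS Fs => tau; case: (PP tau) => _ /[apply]; apply.
exists (fun g => (-1) ^+ b g *: s g) => [g|w]; first exact: nlifts_pm.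
set s' := fun g => _.
have tq g : (fun tau => P tau *m s' g *m invmx (P tau)) @ F --> q g.
  have -> : (fun tau => P tau *m s' g *m invmx (P tau)) =
    (fun tau => (-1) ^+ b g *: t tau g).
    by apply/funext => tau; rewrite /s' /t -scalemxAr -scalemxAl.
  have -> : q g = (-1) ^+ b g *: ((-1) ^+ b g *: q g).
    by rewrite scalerA -expr2 sqrr_sign scale1r.
  by apply: cvgZ; [exact: cvg_cst|exact: bP].
have tw : (fun tau => P tau *m eval s' w *m invmx (P tau)) @ F --> eval q w.
  have -> : (fun tau => P tau *m eval s' w *m invmx (P tau)) =
      (fun tau => eval (fun g => P tau *m s' g *m invmx (P tau)) w).
    by apply/funext => tau; rewrite eval_conj//; case: (PP tau).
  exact: cvg_eval.
have [x [x0 dx tx]] := qw w.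
have detC tau : \det (x%:M - P tau *m eval s' w *m invmx (P tau)) =
  \det (x%:M - eval s' w).
  case: (PP tau) => uP _.
  have -> : x%:M - P tau *m eval s' w *m invmx (P tau) =
    P tau *m (x%:M - eval s' w) *m invmx (P tau).
    by rewrite mulmxBr mulmxBl scalar_mxC mulmxK.
  by rewrite !det_mulmx mulrAC -det_mulmx mulmxV// det1 mul1r.
have trC tau : \tr (P tau *m eval s' w *m invmx (P tau)) = \tr (eval s' w).
  by case: (PP tau) => uP _; rewrite mxtrace_mulC mulKmx.
exists x; split=> //.
- rewrite -dx; apply/esym.
  have cd : (fun tau => \det (x%:M - P tau *m eval s' w *m invmx (P tau))) @ F -->
    \det (x%:M - eval q w).
    by apply: cvg_det; apply: cvgB => //; exact: cvg_cst.
  by apply: (closed_cvg _ (@closed_eq _ _) _ _ cd); apply: nearW.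
- suff -> : \tr (eval s' w) = \tr (eval q w) by [].
  apply/esym; have cd : (fun tau => \tr (P tau *m eval s' w *m invmx (P tau))) @ F -->
    \tr (eval q w).
    exact: cvg_trace.
  by apply: (closed_cvg _ (@closed_eq _ (\tr (eval s' w))) _ _ cd); apply: nearW.
Qed.

Lemma conj_orbit_refl rho : conj_orbit rho rho.
Proof. by exists 1%g => g; rewrite mul1g invg1 mulg1. Qed.

Lemma conj_orbit_sym rho sigma : conj_orbit rho sigma -> conj_orbit sigma rho.
Proof.
move=> [p pE]; exists (p^-1)%g => g.
by rewrite pE invgK !mulgA mulVg mul1g -mulgA mulVg mulg1.
Qed.

(** The property goes from [rho] to [eta] by closedness and conjugation invariance, then from [eta]
    back to [sigma] by [positive_rep_orbit]. *)
Lemma positive_rep_meet rho sigma :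
  orbit_closures_meet rho sigma -> positive_rep rho -> positive_rep sigma.
Proof.
move=> [eta [er es]] Prho; apply: (positive_rep_orbit es).
apply: (closure_subset_closed positive_rep_closed) er => tau /conj_orbit_sym ot.
exact: (positive_rep_orbit (subset_closure ot)).
Qed.

Lemma positive_rep_chi_equiv rho sigma :
  chi_equiv rho sigma -> positive_rep rho <-> positive_rep sigma.
Proof.
move=> /asboolP; elim=> {rho sigma}
  [rho sigma rs|//|rho sigma _ IH|rho sigma tau _ IH1 _ IH2].
- split; apply: positive_rep_meet => //.
  by case: rs => eta [? ?]; exists eta.
- by split=> ?; apply/IH.
- by split=> [/IH1/IH2|/IH2/IH1].
Qed.

End PositiveReps.

(** * Properly convex sets and cones *)

Section ConeOver.
Variables (R : realType) (n : nat).
Local Notation V := 'cV[R]_n.+1.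

(** All homogeneous coordinates, hence a set symmetric under [v |-> - v]; for properly convex
    [Omega] it is split below into two opposite convex halves. *)
Definition cone_over (Omega : set (RP R n)) : set V :=
  [set v | exists2 u : nzvec R n, val u = v & Omega (\pi_(RP R n) u)].

Definition nzvec_of (v : V) (v0 : v != 0) : nzvec R n :=
  exist (fun v => v \in nzvec R n) v (mem_set v0).

Lemma cone_over_neq0 Omega v : cone_over Omega v -> v != 0.
Proof. by case=> u <- _; exact: (set_valP u). Qed.

Lemma cone_over_pi Omega (u : nzvec R n) : cone_over Omega (val u) <->
  Omega (\pi_(RP R n) u).
Proof. by split=> [[u' /val_inj ->]//|h]; exists u. Qed.

Lemma cone_overZ Omega (c : R) v : c != 0 -> cone_over Omega v ->
  cone_over Omega (c *: v).
Proof.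
move=> c0 [u <- Ou]; have cu : c *: val u \in nzvec R n.
  by apply: mem_set; rewrite /nzvec/= scaler_eq0 negb_or c0; exact: (set_valP u).
pose w : nzvec R n := exist (fun v => v \in nzvec R n) (c *: val u) cu.
exists w => //; suff -> : \pi_(RP R n) w = \pi_(RP R n) u by [].
by apply/RP_eqP; exists c.
Qed.

Lemma mx_neq0_open : open [set v : V | v != 0].
Proof.
have -> : [set v : V | v != 0] = ~` [set 0].
  by apply/seteqP; split=> v /=; [move/eqP|move=> h; apply/eqP].
by rewrite openC; exact: mx_closed1.
Qed.

Lemma cone_over_open Omega : open Omega -> open (cone_over Omega).
Proof.
move=> [W oW WE].
have -> : cone_over Omega = W `&` [set v | v != 0].
  apply/seteqP; split=> v.
    move=> [u <- Ou]; split; last exact: (set_valP u).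
    by have : (val @^-1` W) u by rewrite WE.
  move=> [Wv v0]; pose u : nzvec R n := nzvec_of v0.
  exists u => //; have : (val @^-1` W) u by [].
  by rewrite WE.
by apply: openI => //; exact: mx_neq0_open.
Qed.

Lemma open_cone_over Omega : open (cone_over Omega) -> open Omega.
Proof.
move=> oO; exists (cone_over Omega) => //.
by apply/seteqP; split=> u /=; rewrite cone_over_pi.
Qed.

Lemma closure_cone_over Omega (u : nzvec R n) :
  closure (cone_over Omega) (val u) -> closure Omega (\pi_(RP R n) u).
Proof.
move=> clu U; rewrite nbhsE => -[U' [oU' U'u] U'U].
have : cone_over U' (val u) by apply/cone_over_pi.
move=> /(conj (cone_over_open oU')) /open_nbhs_nbhs /clu[v [[w <- Ow]]] /cone_over_pi
  U'w.
by exists (\pi_(RP R n) w); split=> //; exact: U'U.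
Qed.

Lemma cone_over_closed Omega : closed (cone_over Omega `|` [set 0]) -> closed Omega.
Proof.
move=> cO; rewrite -openC; apply: open_cone_over.
have -> : cone_over (~` Omega) = ~` (cone_over Omega `|` [set 0]);
  last by rewrite openC.
apply/seteqP; split=> v.
  move=> [u <- nO] [/cone_over_pi//|/eqP]; exact/negP/(set_valP u).
move=> /not_orP[nO /eqP v0]; pose u : nzvec R n := nzvec_of v0.
by exists u => // /cone_over_pi.
Qed.

Lemma lifts_cone_over Omega M p : lifts M p ->
  pact p @` Omega `<=` Omega -> forall v, cone_over Omega v -> cone_over Omega (M *m v).
Proof.
move=> [A <- <-] pO _ [u <- Ou]; exists (GLact A u) => //.
by rewrite -pactE; apply: pO; exists (\pi_(RP R n) u).
Qed.

Lemma pactM (p q : PGL R n) x : pact (p * q)%g x = pact p (pact q x).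
Proof.
elim/quotW: p => A; elim/quotW: q => B; elim/quotW: x => v.
rewrite -[(_ * _)%g]/(PGLmul _ _) PGLmulE (pactE B v) !pactE; congr (\pi_(RP R n) _).
by apply: val_inj; rewrite /= mulmxA.
Qed.

Lemma pact1 (x : RP R n) : pact 1%g x = x.
Proof.
elim/quotW: x => v; have -> : (1%g : PGL R n) = \pi_(PGL R n) (GLone R n) by [].
rewrite pactE; congr (\pi_(RP R n) _).
by apply: val_inj; rewrite /= mul1mx.
Qed.

(** * The two halves of the cone over a properly convex set *)

Section ProperlyConvex.
Variable Omega : set (RP R n).
Hypothesis Opc : properly_convex Omega.
Let O := cone_over Omega.

Let O_open : open O. Proof. by apply: cone_over_open; case: Opc. Qed.
Let OZ (c : R) v : c != 0 -> O v -> O (c *: v). Proof. exact: cone_overZ. Qed.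
Let ON v : O v -> O (- v).
Proof. by move=> Ov; rewrite -scaleN1r; apply: OZ => //; rewrite oppr_eq0 oner_eq0. Qed.
Let O0 : ~ O 0. Proof. by move=> /cone_over_neq0; rewrite eqxx. Qed.

(** The absence of projective lines in the closure of [Omega], in homogeneous coordinates on the
    plane spanned by [v] and [w]. *)
Lemma no_plane (v w : V) : v != 0 -> (forall k : R, w <> k *: v) ->
  ~ forall s t : R, (s != 0) || (t != 0) -> closure O (s *: w + t *: v).
Proof.
move=> v0 wv h; have [_ _ _ nL] := Opc.
pose X := [tuple w; v].
have fX : free X.
  rewrite /= free_cons span_seq1 seq1_free v0 andbT.
  by apply/negP => /vlineP[k]; exact: wv.
have dW : \dim (span X) = 2%N by apply/eqP.
apply: (nL (proj_subspace (span X))); first by exists (span X).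
move=> x [u /= Wu <-]; apply: closure_cone_over.
have u0 : val u != 0 := set_valP u.
have uE := coord_span Wu; rewrite !big_ord_recl big_ord0 addr0 /= in uE.
move: (coord X _ _) (coord X _ _) uE => t s uE.
have {}uE : val u = s *: w + t *: v := uE.
rewrite uE; apply: h; apply: contraT; rewrite negb_or !negbK => /andP[/eqP s0 /eqP t0].
by move: u0; rewrite uE s0 t0 !scale0r addr0 eqxx.
Qed.

(* In particular w is not a negative multiple of v. *)
Definition arc (v w : V) : Prop :=
  forall s t : R, 0 <= s -> 0 <= t -> 0 < s + t -> O (s *: v + t *: w).

(** Convexity provides a segment on which [v] and [w] are multiples, by [c] and [d], of nonnegative
    combinations of [a] and [b]; whether [c] and [d] have the same sign decides the case.
    Proportional vectors are treated apart, as one of the two arcs then passes through 0. *)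
Lemma arc_dichotomy v w : O v -> O w -> arc v w \/ arc v (- w).
Proof.
move=> Ov Ow; have v0 := cone_over_neq0 Ov; have w0 := cone_over_neq0 Ow.
have [[k wk]|nk] := pselect (exists k : R, w = k *: v).
  have k0 : k != 0 by apply: contra_neq w0; rewrite wk => ->; rewrite scale0r.
  have [k_gt0|k_lt0|/esym/eqP] := ltgtP 0 k; last by rewrite (negbTE k0).
    left=> s t s0 t0 st; rewrite wk scalerA -scalerDl; apply: OZ => //.
    by rewrite gt_eqF//; nra.
  right=> s t s0 t0 st; rewrite wk -scaleNr scalerA -scalerDl; apply: OZ => //.
  by rewrite gt_eqF//; nra.
have vw s t : 0 < s + t -> 0 <= s -> 0 <= t -> s *: v + t *: w != 0.
  move=> st s0 t0; have [tz|tz] := eqVneq t 0.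
    by rewrite tz scale0r addr0 scaler_eq0 (negbTE v0) orbF; apply/eqP; lra.
  apply: contra_notN nk => /eqP h; exists (- (t^-1 * s)).
  apply: (scalerI tz); rewrite scalerA mulrN mulVKf// scaleNr.
  by apply/eqP; rewrite -addr_eq0 addrC h.
have vNw s t : 0 < s + t -> 0 <= s -> 0 <= t -> s *: v + t *: - w != 0.
  move=> st s0 t0; have [tz|tz] := eqVneq t 0.
    by rewrite tz scale0r addr0 scaler_eq0 (negbTE v0) orbF; apply/eqP; lra.
  apply: contra_notN nk => /eqP h; exists (t^-1 * s).
  apply: (scalerI tz); rewrite scalerA mulVKf//.
  by apply/eqP; rewrite eq_sym -subr_eq0 -scalerN h.
have [Ocv _ _ _] := Opc.
have [u uv Ou] := Ov; have [x xw Ox] := Ow.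
have [a [b [[u1 [s1 [t1 [s10 t10 u1E]]] u1u] [x1 [s2 [t2 [s20 t20 x1E]]] x1x] ab]]] :=
  Ocv _ _ Ou Ox.
have Oab s t : 0 <= s -> 0 <= t -> s *: a + t *: b != 0 -> O (s *: a + t *: b).
  move=> s0 t0 st; pose y : nzvec R n := nzvec_of st.
  by exists y => //; apply: ab; exists y => //; exists s, t.
have [c c0 uc] : exists2 c : R, c != 0 & v = c *: (s1 *: a + t1 *: b).
  by move/esym/RP_eqP: u1u => [c c0]; rewrite uv u1E => ?; exists c.
have [d d0 xd] : exists2 d : R, d != 0 & w = d *: (s2 *: a + t2 *: b).
  by move/esym/RP_eqP: x1x => [d d0]; rewrite xw x1E => ?; exists d.
have comb s t c' d' : 0 <= s -> 0 <= t -> 0 <= c' -> 0 <= d' ->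
    s *: (c' *: (s1 *: a + t1 *: b)) + t *: (d' *: (s2 *: a + t2 *: b)) != 0 ->
    O (s *: (c' *: (s1 *: a + t1 *: b)) + t *: (d' *: (s2 *: a + t2 *: b))).
  move=> s0 t0 c'0 d'0.
  have -> : s *: (c' *: (s1 *: a + t1 *: b)) + t *: (d' *: (s2 *: a + t2 *: b)) =
    (s * c' * s1 + t * d' * s2) *: a + (s * c' * t1 + t * d' * t2) *: b.
    by rewrite !scalerDr !scalerA addrACA -!scalerDl.
  by apply: Oab; rewrite addr_ge0// !mulr_ge0.
have [c_gt0|c_lt0|/esym/eqP] := ltgtP 0 c; last by rewrite (negbTE c0).
  have [d_gt0|d_lt0|/esym/eqP] := ltgtP 0 d; last by rewrite (negbTE d0).
    left=> s t s0 t0 st; have := vw _ _ st s0 t0; rewrite uc xd; apply: comb => //;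
      exact: ltW.
  right=> s t s0 t0 st; have := vNw _ _ st s0 t0; rewrite uc xd -scaleNr;
    apply: comb => //; first exact: ltW.
  by rewrite oppr_ge0 ltW.
have [d_gt0|d_lt0|/esym/eqP] := ltgtP 0 d; last by rewrite (negbTE d0).
  right=> s t s0 t0 st; have := vNw _ _ st s0 t0; rewrite -oppr_eq0 => h.
  rewrite -[X in O X]opprK; apply: ON; move: h;
    rewrite opprD -!scalerN opprK uc xd -scaleNr.
  by apply: comb => //; [rewrite oppr_ge0 ltW|exact: ltW].
left=> s t s0 t0 st; have := vw _ _ st s0 t0; rewrite -oppr_eq0 => h.
rewrite -[X in O X]opprK; apply: ON; move: h; rewrite opprD -!scalerN uc xd -!scaleNr.
by apply: comb => //; rewrite oppr_ge0 ltW.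
Qed.

(* The vectors v with [arc v0 v] form one of the two components of the cone over Omega:
   they and their opposites form two disjoint open sets covering it, so no arc joins
   them, and the component is convex. *)
Section Component.
Variable v0 : V.
Hypothesis Ov0 : O v0.

Let C : set V := [set v | arc v0 v].

Lemma arc_over v : C v -> O v.
Proof. by move=> /(_ 0 1); rewrite scale0r add0r scale1r add0r; apply. Qed.

Lemma arc_refl : C v0.
Proof. by move=> s t _ _ st; rewrite -scalerDl; apply: OZ; rewrite ?gt_eqF. Qed.

(** Both arcs and their opposites would fill the plane of [v0] and [v] minus 0, against [no_plane].
    If [v] is a multiple of [v0], one of the arcs would contain 0. *)
Lemma arc_opp v : C v -> ~ C (- v).
Proof.
move=> Cv CNv; have v0n0 := cone_over_neq0 Ov0; have vn0 :=
  cone_over_neq0 (arc_over Cv).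
have [[k vk]|nk] := pselect (exists k : R, v = k *: v0).
  have k0 : k != 0 by apply: contra_neq vn0; rewrite vk => ->; rewrite scale0r.
  have [k_gt0|k_lt0|/esym/eqP] := ltgtP 0 k; last by rewrite (negbTE k0).
    have := CNv k 1 (ltW k_gt0) ler01; rewrite scale1r vk subrr => /(_ _)/O0; apply.
    by rewrite addr_gt0.
  have := Cv (- k) 1; rewrite scale1r vk scaleNr addNr => h; apply: O0; apply: h; lra.
apply: (no_plane v0n0 (w := v)) => [k vk|s t st]; first by apply: nk; exists k.
apply: subset_closure.
wlog t0 : s t st / 0 <= t => [H|].
  have [/H|/ltW t0] := leP 0 t; first exact.
  rewrite -[X in O X]opprK opprD -!scaleNr; apply: ON; apply: H; rewrite ?oppr_eq0//.
  by rewrite oppr_ge0.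
have [s0|s0] := leP 0 s.
  rewrite addrC; apply: Cv => //; case/orP: st => st;
    last by rewrite ltr_pwDl// lt_def st.
  by rewrite ltr_wpDl// lt_def st.
rewrite addrC -[s]opprK scaleNr -scalerN; apply: CNv => //; lra.
Qed.

Lemma arcZ c v : 0 < c -> C v -> C (c *: v).
Proof.
move=> c0 Cv s t s0 t0 st; rewrite scalerA; apply: Cv => //;
  first by rewrite mulr_ge0// ltW.
have [tz|tz] := eqVneq t 0; first by move: st; rewrite tz mul0r.
by rewrite ltr_wpDl// mulr_gt0// lt_def tz.
Qed.

(** If points outside [C] tend to [v], each has an arc leaving [O] at some parameter in the unit
    interval; these parameters converge along the ultrafilter, and the arc to [v] leaves the open
    set [O] at their limit. *)
Lemma arc_open : open C.
Proof.
rewrite -closedC; apply: closed_ultra => F v FU Fv FC /= Cv.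
have [l lP] : {l : V -> R & forall w, (~` C) w ->
  0 <= l w <= 1 /\ ~ O ((1 - l w) *: v0 + l w *: w)}.
  apply: (@choice _ _ (fun w l => (~` C) w ->
    0 <= l <= 1 /\ ~ O ((1 - l) *: v0 + l *: w))) => w.
  have [Cw|nCw] := pselect (C w); first by exists 0.
  have [s [t [s0 t0 st nO]]] : exists s t : R,
    [/\ 0 <= s, 0 <= t, 0 < s + t & ~ O (s *: v0 + t *: w)].
    apply: contrapT => h; apply: nCw => s t s0 t0 st; apply: contrapT => nO.
    by apply: h; exists s, t.
  have stn0 : s + t != 0 by rewrite gt_eqF.
  exists (t / (s + t)) => _; split.
    by rewrite divr_ge0 ?ler_pdivrMr ?mul1r ?lerDr// addr_ge0.
  move=> Ost; apply: nO.
  have -> : s *: v0 + t *: w = (s + t) *: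
    ((1 - t / (s + t)) *: v0 + (t / (s + t)) *: w).
    rewrite scalerDr !scalerA mulrBr mulr1 mulrCA divff// mulr1 addrK//.
  exact: OZ.
have lb : \forall w \near F, `|l w| <= 1.
  by apply: filterS FC => w /lP[/andP[l0 l1] _]; rewrite ger0_norm.
have [x lx] := ultra_bounded_real FU lb.
have nO : \forall w \near F, (~` O) ((1 - l w) *: v0 + l w *: w) by apply: filterS
  FC => w /lP[].
have lim : (fun w => (1 - l w) *: v0 + l w *: w) @ F --> (1 - x) *: v0 + x *: v.
  apply: cvgD; last by apply: cvgZ.
  by apply: cvgZ; [apply: cvgB => //; exact: cvg_cst|exact: cvg_cst].
have Oc : closed (~` O) by rewrite closedC.
have /= := closed_cvg _ Oc nO _ lim; apply; apply: Cv; last by lra.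
  have l1 : \forall w \near F, l w <= 1 by apply: filterS FC => w /lP[/andP[]].
  by rewrite subr_ge0; apply: (closed_cvg _ (@closed_le _ 1) l1 _ lx).
have l0 : \forall w \near F, 0 <= l w by apply: filterS FC => w /lP[/andP[]].
exact: (closed_cvg _ (@closed_ge _ 0) l0 _ lx).
Qed.

Lemma arc_path a b : arc a b -> C a -> C b.
Proof.
move=> ab Ca; pose f (l : R) := (1 - l) *: a + l *: b.
have fO l : l \in `[0, 1] -> O (f l).
  by rewrite in_itv/= => /andP[l0 l1]; apply: ab; lra.
have fc : continuous f.
  move=> l; apply: (@cvgD _ _ _ (nbhs l)).
    apply: (@cvgZ _ _ _ (nbhs l)); last exact: cvg_cst.
    by apply: (@cvgB _ _ _ (nbhs l)); [exact: cvg_cst|exact: cvg_id].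
  by apply: (@cvgZ _ _ _ (nbhs l)); [exact: cvg_id|exact: cvg_cst].
have : `[0, 1]%classic `&` f @^-1` C = `[0, 1]%classic.
  apply: (@segment_connected R 0 1).
  - by exists 0; split; rewrite /= ?in_itv/= ?lexx ?ler01// /f subr0 scale1r scale0r
    addr0.
  - exists (f @^-1` C) => //; apply: open_comp; last exact: arc_open.
    by move=> l _; exact: fc.
  - exists (~` (f @^-1` [set v | C (- v)])).
      rewrite closedC; apply: open_comp; first by move=> l _; exact: fc.
      have -> : [set v | C (- v)] = (fun v => - v) @^-1` C by [].
      apply: open_comp; last exact: arc_open.
      by move=> w _; apply: (@cvgN _ _ _ (nbhs w)); exact: cvg_id.
    apply/seteqP; split=> l [l01 h]; split=> //; first exact: arc_opp.
    by case: (arc_dichotomy Ov0 (fO _ l01)).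
move=> /seteqP[_ /(_ 1)] [|_].
  by rewrite /= in_itv/= lexx ler01.
by rewrite /f /= subrr scale0r add0r scale1r.
Qed.

Lemma arcD a b : C a -> C b -> C (a + b).
Proof.
move=> Ca Cb; have [ab|ab] := arc_dichotomy (arc_over Ca) (arc_over Cb); last first.
  by case: (arc_opp Cb); exact: arc_path ab Ca.
apply: arc_path Ca => s t s0 t0 st; rewrite scalerDr addrA -scalerDl; apply: ab; lra.
Qed.

Let C0 : set V := C `|` [set 0].

Lemma arc_cone : cone C0.
Proof.
split; first by right.
  move=> x y [Cx|->] [Cy|->]; rewrite ?addr0 ?add0r;
    [left; exact: arcD|by left|by left|by right].
move=> c x; rewrite le_eqVlt => /orP[/eqP <- _|c0 [Cx|->]].
- by right; rewrite scale0r.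
- by left; exact: arcZ.
- by right; rewrite scaler0.
Qed.

Lemma arc_ball v : C v -> exists2 d : R, 0 < d & forall z, `|z| <= d -> C (v + z).
Proof.
move=> Cv; have /nbhs_ballP[d /= d0 dC] : nbhs v C by apply: open_nbhs_nbhs; split =>
  //; exact: arc_open.
exists (d / 2); first exact: divr_gt0.
move=> z zd; apply: dC; rewrite -ball_normE /ball_/= opprD addrA subrr sub0r normrN.
by apply: le_lt_trans zd _; rewrite ltr_pdivrMr// ltr_pMr// ltr1n.
Qed.

(** The error of an approximation of [k] from the cone is absorbed by a ball around [u]. *)
Lemma arc_closureD u k : C u -> closure C0 k -> C (u + k).
Proof.
move=> Cu; have [d d0 dC] := arc_ball Cu.
move=> /(_ (ball k d) (nbhsx_ballx _ _ d0))[y [Cy]].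
rewrite -ball_normE /ball_/= => /ltW/dC uky.
have -> : u + k = (u + (k - y)) + y by rewrite -addrA subrK.
case: Cy => [Cy|/= y0]; first exact: arcD.
by rewrite {2}y0 addr0.
Qed.

(** If the closure contained the line spanned by [x], all [v0 + c *: x] would lie in [C]; scaling
    and limits would put the whole plane of [x] and [v0], up to 0, in the closure of [O]. *)
Lemma arc_closure_sharp : sharp (closure C0).
Proof.
move=> x Kx KNx; apply/eqP; apply: contraT => x0.
have [_ _ KZ] := closure_cone arc_cone.
have KR c : closure C0 (c *: x).
  have [c0|/ltW c0] := leP 0 c; first exact: KZ.
  by rewrite -[c]opprK scaleNr -scalerN; apply: KZ; rewrite ?oppr_ge0.
have Cux c : C (v0 + c *: x) by apply: arc_closureD => //; exact: arc_refl.
have v0n0 := cone_over_neq0 Ov0.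
have [[k xk]|nk] := pselect (exists k : R, x = k *: v0).
  have k0 : k != 0 by apply: contra_neq x0; rewrite xk => ->; rewrite scale0r.
  have := Cux (- k^-1); rewrite xk scalerA mulNr mulVf// scaleN1r subrr.
  by move=> /arc_over/O0.
exfalso; apply: (no_plane v0n0 (w := x)) => [k xk|s t st]; first by apply: nk; exists k.
have Opos s' t' : 0 < t' -> O (s' *: x + t' *: v0).
  move=> t'0; have -> : s' *: x + t' *: v0 = t' *: (v0 + (s' / t') *: x).
    by rewrite scalerDr scalerA mulrCA divff ?gt_eqF// mulr1 addrC.
  by apply: OZ; [rewrite gt_eqF|exact: arc_over].
have [t0|t0|t0] := ltgtP 0 t.
- by apply: subset_closure; exact: Opos.
- apply: subset_closure; rewrite -[X in O X]opprK; apply: ON; rewrite opprD -!scaleNr.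
  by apply: Opos; rewrite oppr_gt0.
- rewrite -t0 scale0r addr0.
  have lim : (fun k => s *: x + @harmonic R k *: v0) @ \oo --> s *: x.
    rewrite -[X in _ --> X]addr0; apply: cvgD; first exact: cvg_cst.
    by rewrite -(scale0r v0); apply: cvgZ; [exact: cvg_harmonic|exact: cvg_cst].
  apply: (closed_cvg _ (@closed_closure _ O) _ _ lim); apply: nearW => k.
  by apply: subset_closure; apply: Opos; exact: harmonic_gt0.
Qed.

End Component.

(** [M] sends the chosen half into itself or into the opposite one; [arc_dichotomy] at [M *m v0]
    picks the sign, and [arc_path] carries it to the other vectors. *)
Lemma properly_convex_cone (F : 'M[R]_n.+1 -> Prop) :
  (forall M, F M -> forall v, O v -> O (M *m v)) ->
  exists K : set V, [/\ closed K, cone K, sharp K, exists u, interior_point K u &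
    forall M, F M -> exists b : bool, forall v, K v -> K ((-1) ^+ b *: M *m v)].
Proof.
move=> FO; have [_ [x Ox] _ _] := Opc.
have Ov0 : O (val (repr x)) by apply/cone_over_pi; rewrite reprK.
move: (val (repr x)) Ov0 => v0 Ov0 {x Ox}.
pose C : set V := [set v | arc v0 v].
exists (closure (C `|` [set 0])); split.
- exact: closed_closure.
- exact/closure_cone/arc_cone.
- exact: arc_closure_sharp.
- have [d d0 dC] := arc_ball (arc_refl Ov0); exists v0, d => // z /dC h.
  by apply: subset_closure; left.
move=> M FM.
have [b Cb] : exists b : bool, C ((-1) ^+ b *: M *m v0).
  have [h|h] := arc_dichotomy Ov0 (FO _ FM _ Ov0); [exists false|exists true].
    by rewrite expr0 scale1r.
  by rewrite expr1 scaleN1r mulNmx.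
exists b; apply: closure_mulmx => v [Cv|->]; last by right; rewrite mulmx0.
left; apply: (arc_path Ov0) Cb => s t s0 t0 st.
rewrite -!scalemxAl !(scalerA, =^~ scalemxAr).
rewrite mulrC (mulrC t) -!scalerA -scalerDr !scalemxAr -mulmxDr.
apply: OZ; first by rewrite signr_eq0.
by apply: FO => //; apply: Cv.
Qed.

End ProperlyConvex.

Lemma properly_convex_positive (G : groupType) :
  @preserves_properly_convex R n G `<=` @positive_rep R n G.
Proof.
move=> rho [Om [Opc _ pO]].
have [r lr] := rep_lift_ex rho.
pose F (M : 'M[R]_n.+1) : Prop := (exists g, M = r g).
have FO M : F M -> forall v, cone_over Om v -> cone_over Om (M *m v).
  move=> [g ->]; have [lg _] := lr g; apply: (lifts_cone_over lg).
  by rewrite pO.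
have [K [Kcl cK sK [u ui] KF]] := properly_convex_cone Opc FO.
have [b bP] : {b : G -> bool & forall g v, K v -> K ((-1) ^+ b g *: r g *m v)}.
  apply: (@choice _ _ (fun g (b : bool) => forall v, K v -> K ((-1) ^+ b *: r g *m v))) => g.
  by apply: KF; exists g.
exists (fun g => (-1) ^+ b g *: r g) => [g|w]; first exact: nlifts_pm.
apply: (PF_cone Kcl cK sK ui).
have [K0 KD KZ] := cK.
elim: w => [g|w1 IH1 w2 IH2|w1 IH1 w2 IH2|c w IH] x Kx /=.
- exact: bP.
- by rewrite mulmxDl; apply: KD; [exact: IH1|exact: IH2].
- by rewrite -mulmxA; apply: IH1; exact: IH2.
- by rewrite -scalemxAl; apply: KZ => //; exact: IH.
Qed.

End ConeOver.

(** * From an invariant sharp cone to a properly convex domain *)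

Section Projectivization.
Variables (R : realType) (n : nat).
Local Notation V := 'cV[R]_n.+1.

Variable C : set V.
Hypotheses (Ccl : closed C) (cC : cone C) (sC : sharp C).

Let CD x y : C x -> C y -> C (x + y). Proof. by case: cC => _ h _; apply: h. Qed.
Let CZ c x : 0 <= c -> C x -> C (c *: x). Proof. by case: cC => _ _; apply. Qed.

Let U : set V := [set v | interior_point C v].

Lemma interior_point_open : open U.
Proof.
rewrite openE => v [d d0 dC]; apply/nbhs_ballP; exists (d / 2) => /=;
  first exact: divr_gt0.
move=> w; rewrite -ball_normE /ball_/= => /ltW vw.
exists (d / 2) => [|z zd]; first exact: divr_gt0.
have -> : w + z = v + (z - (v - w)) by rewrite opprB [z + _]addrC addrA [v + _]addrC
  subrK.
apply: dC; rewrite (le_trans (ler_normB _ _))//; lra.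
Qed.

Lemma interior_pointZ c v : 0 < c -> U v -> U (c *: v).
Proof.
move=> c0 [d d0 dC]; exists (c * d) => [|z zd]; first exact: mulr_gt0.
have -> : c *: v + z = c *: (v + c^-1 *: z).
  by rewrite scalerDr scalerA divff ?scale1r ?gt_eqF.
apply: CZ; first exact: ltW.
by apply: dC; rewrite normrZ normfV (gtr0_norm c0) ler_pdivrMl.
Qed.

Lemma interior_pointD v w : U v -> C w -> U (v + w).
Proof. by move=> [d d0 dC] Cw; exists d => // z zd; rewrite addrAC; apply: CD => //;
  exact: dC. Qed.

Lemma interior_point_mulmx M v : M \in unitmx -> (forall x, C x -> C (M *m x)) ->
  U v -> U (M *m v).
Proof.
move=> uM MC [d d0 dC]; pose b := n.+1%:R * `|invmx M| + 1.
have b0 : 0 < b by rewrite ltr_wpDl// mulr_ge0.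
exists (d / b) => [|z zd]; first exact: divr_gt0.
have -> : M *m v + z = M *m (v + invmx M *m z) by rewrite mulmxDr mulKVmx.
apply: MC; apply: dC; rewrite (le_trans (mulmx_norm_le _ _))// mulrA.
move: zd; rewrite ler_pdivlMr// => zd; apply: le_trans zd.
by rewrite mulrC /b mulrDr mulr1 lerDl.
Qed.

Let Omega : set (RP R n) := projectivization U.

Lemma cone_over_projectivization (S : set V) : (forall c v, 0 < c -> S v -> S (c *: v))
  ->
  cone_over (projectivization S) = (S `|` [set v | S (- v)]) `&` [set v | v != 0].
Proof.
move=> SZ; apply/seteqP; split=> v.
  move=> [u <- [w Sw wu]]; split; last exact: (set_valP u).
  move/RP_eqP: wu => [c c0 wE]; rewrite /= wE in Sw.
  have [c_gt0|c_lt0|/esym/eqP] := ltgtP 0 c; last by rewrite (negbTE c0).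
    left; have := SZ c^-1 _ _ Sw; rewrite scalerA mulVf// scale1r; apply.
    by rewrite invr_gt0.
  right; have := SZ (- c^-1) _ _ Sw; rewrite scalerA mulNr mulVf// scaleN1r; apply.
  by rewrite oppr_gt0 invr_lt0.
move=> [Sv v0]; pose u : nzvec R n := nzvec_of v0.
case: Sv => [Sv|SNv]; first by exists u => //; exists u.
have nv0 : - v != 0 by rewrite oppr_eq0.
pose w : nzvec R n := nzvec_of nv0.
exists u => //; exists w => //; apply/RP_eqP; exists (-1);
  rewrite ?oppr_eq0 ?oner_eq0//=.
by rewrite scaleN1r.
Qed.

Lemma cone_over_interior : cone_over Omega = U `|` [set v | U (- v)].
Proof.
rewrite cone_over_projectivization; last exact: interior_pointZ.
apply/seteqP; split=> [v []//|v h]; split=> //.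
by case: h => /(interior_point_neq0 sC)//; rewrite oppr_eq0.
Qed.

Lemma projectivization_interior_open : open Omega.
Proof.
apply: open_cone_over; rewrite cone_over_interior; apply: openU;
  first exact: interior_point_open.
have -> : [set v | U (- v)] = (fun v => - v) @^-1` U by [].
apply: open_comp; last exact: interior_point_open.
by move=> w _; apply: (@cvgN _ _ _ (nbhs w)); exact: cvg_id.
Qed.

Lemma oppr_cone_closed : closed [set v | C (- v)].
Proof.
have -> : [set v | C (- v)] = (fun v => - v) @^-1` C by [].
by apply: preimage_closed => // w _; apply: (@cvgN _ _ _ (nbhs w)); exact: cvg_id.
Qed.

Lemma closure_projectivization_interior : closure Omega `<=` projectivization C.
Proof.
apply: closure_subset_closed; last first.
  by move=> x [u Uu <-]; exists u => //; exact: interior_point_mem.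
apply: cone_over_closed; rewrite cone_over_projectivization; last by move=> c v c0;
  apply: CZ; exact: ltW.
have -> : (C `|` [set v | C (- v)]) `&` [set v | v != 0] `|` [set 0] =
  C `|` [set v | C (- v)].
  apply/seteqP; split=> v; first by move=> [[]//|->]; left; case: cC.
  by move=> h; have [->|v0] := eqVneq v 0; [right|left].
by apply: closedU => //; exact: oppr_cone_closed.
Qed.

(** A plane [W] covered by [C] and its opposite contains independent [a] and [b] in [C]. The path
    from [a] to [- b] avoids 0, so by connectedness it stays in [C]; then [b] and [- b] are both in
    [C]. *)
Lemma projectivization_interior_no_line L : proj_line L -> ~ (L `<=` closure Omega).
Proof.
move=> [W dW ->] WO.
have WC v : v \in W -> C v \/ C (- v).
  move=> vW; have [->|v0] := eqVneq v 0; first by left; case: cC.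
  pose u : nzvec R n := nzvec_of v0.
  have : cone_over (projectivization C) v.
    by exists u => //; apply: closure_projectivization_interior; apply: WO; exists u.
  by rewrite cone_over_projectivization => [[]|c w c0]; last by apply: CZ; exact: ltW.
have [a [b [aW bW [Ca Cb] [a0 nab]]]] : exists a b, [/\ a \in W, b \in W, C a /\ C b &
    a != 0 /\ forall k : R, b <> k *: a].
  have [x [y [xW yW y0 nxy]]] : exists x y, [/\ x \in W, y \in W, y != 0 &
      forall k : R, x <> k *: y].
    have := basis_free (vbasisP W); have := @vbasis_mem _ _ ^~ W.
    move: (vbasis W); rewrite dW => X; case/tupleP: X => x X; case/tupleP: X => y X.
    rewrite [X]tuple0 /= => memX; rewrite free_cons span_seq1 seq1_free =>
      /andP[/vlineP nxy y0].
    exists x, y; split=> //; first by apply: memX; rewrite !inE eqxx.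
      by apply: memX; rewrite !inE eqxx orbT.
    by move=> k h; apply: nxy; exists k.
  have [e [eW Ce e0 ne]] : exists e,
    [/\ e \in W, C e, e != 0 & forall k : R, x <> k *: e].
    have [Cy|Cy] := WC _ yW; first by exists y.
    exists (- y); rewrite rpredN oppr_eq0; split=> // k; rewrite scalerN -scaleNr;
      exact: nxy.
  exists e; have [Cx|Cx] := WC _ xW; first by exists x.
  exists (- x); rewrite rpredN; split=> //; split=> // k /eqP.
  by rewrite eqr_oppLR -scaleNr => /eqP; exact: ne.
pose f (l : R) := (1 - l) *: a - l *: b.
have fW l : f l \in W by rewrite /f rpredB// rpredZ.
have f0 l : f l != 0.
  have [->|l0] := eqVneq l 0; first by rewrite /f subr0 scale1r scale0r subr0.
  apply/eqP => /eqP; rewrite subr_eq0 => /eqP h; apply: (nab (l^-1 * (1 - l))).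
  by rewrite -scalerA h scalerA mulVf// scale1r.
have fc : continuous f.
  move=> l; apply: (@cvgB _ _ _ (nbhs l)).
    apply: (@cvgZ _ _ _ (nbhs l)); last exact: cvg_cst.
    by apply: (@cvgB _ _ _ (nbhs l)); [exact: cvg_cst|exact: cvg_id].
  by apply: (@cvgZ _ _ _ (nbhs l)); [exact: cvg_id|exact: cvg_cst].
have excl l : C (f l) -> ~ C (- f l).
  by move=> h1 h2; have := f0 l; rewrite (sC h1 h2) eqxx.
have : `[0, 1]%classic `&` f @^-1` C = `[0, 1]%classic.
  apply: (@segment_connected R 0 1).
  - by exists 0; split; rewrite /= ?in_itv/= ?lexx ?ler01// /f subr0 scale1r scale0r
    subr0.
  - exists (f @^-1` (~` [set v | C (- v)])).
      apply: open_comp; first by move=> l _; exact: fc.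
      by rewrite openC; exact: oppr_cone_closed.
    apply/seteqP; split=> l [l01 h]; split=> //; first exact: excl.
    by case: (WC _ (fW l)).
  - by exists (f @^-1` C) => //; apply: preimage_closed => // l _; exact: fc.
move=> /seteqP[_ /(_ 1)] [|_].
  by rewrite /= in_itv/= lexx ler01.
rewrite /f /= subrr scale0r add0r scale1r => CNb.
by apply: (nab 0); rewrite scale0r; exact: sC.
Qed.

Lemma projectivization_interior_properly_convex u : U u -> properly_convex Omega.
Proof.
move=> Uu; split.
- move=> x y [a Ua <-] [b Ub <-]; exists (val a), (val b); split.
  + by exists a => //; exists 1, 0; rewrite lexx ler01 scale1r scale0r addr0.
  + by exists b => //; exists 0, 1; rewrite lexx ler01 scale1r scale0r add0r.
  + move=> z [v [s [t [s0 t0 vE]]] <-]; exists v => //=.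
    have [sz|sz] := eqVneq s 0.
      have [tz|tz] := eqVneq t 0.
        have := set_valP v; rewrite /nzvec/= => /eqP v0; exfalso; apply: v0.
        by rewrite -[LHS]/(val v) vE sz tz !scale0r addr0.
      rewrite vE sz scale0r add0r; apply: interior_pointZ => //.
      by rewrite lt_def tz.
    rewrite vE; apply: interior_pointD; first by apply: interior_pointZ;
      rewrite // lt_def sz.
    by apply: CZ => //; exact: interior_point_mem.
- pose v : nzvec R n := nzvec_of (interior_point_neq0 sC Uu).
  by exists (\pi_(RP R n) v), v.
- exact: projectivization_interior_open.
- exact: projectivization_interior_no_line.
Qed.

Lemma projectivization_interior_dim u : U u -> has_proj_dim Omega n.
Proof.
move=> Uu; exists fullv; split.
- by rewrite dimvf /dim/= muln1.
- by move=> x [v _ <-]; exists v => //=; rewrite memvf.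
move=> W OW.
have UW v : U v -> v \in W.
  move=> Uv; pose w : nzvec R n := nzvec_of (interior_point_neq0 sC Uv).
  have : Omega (\pi_(RP R n) w) by exists w.
  move=> /OW[w' /= w'W /esym/RP_eqP[c c0 /= wE]].
  by rewrite wE rpredZ.
apply/subvP => z _; have [d d0 dC] := Uu.
pose e := d / 2 / (`|z| + 1).
have e0 : 0 < e by rewrite !divr_gt0// ltr_wpDl.
have : U (u + e *: z).
  exists (d / 2) => [|y yd]; first exact: divr_gt0.
  rewrite -addrA; apply: dC; rewrite (le_trans (ler_normD _ _))//.
  rewrite normrZ gtr0_norm// /e; suff : d / 2 / (`|z| + 1) * `|z| <= d / 2 by lra.
  rewrite mulrAC ler_pdivrMr ?ltr_wpDl// ler_pM2l ?divr_gt0// lerDl//.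
move=> /UW uz; have := rpredB uz (UW _ Uu); rewrite addrAC subrr add0r => ez.
by have := rpredZ e^-1 ez; rewrite scalerA mulVf ?scale1r ?gt_eqF.
Qed.

Lemma preserved_cone_properly_convex u (G : groupType) (rho : HomPGL R n G) : U u ->
  (forall g, exists2 M, lifts M (rep_fun rho g) & forall x, C x -> C (M *m x)) ->
  preserves_properly_convex R n G rho.
Proof.
move=> Uu rC; exists Omega; split;
  [exact: projectivization_interior_properly_convex Uu|exact:
    projectivization_interior_dim Uu|].
have sub g : pact (rep_fun rho g) @` Omega `<=` Omega.
  move=> _ [_ [v Uv <-] <-]; have [M [A AM <-] MC] := rC g.
  rewrite pactE; exists (GLact A v) => //=.
  by apply: interior_point_mulmx => //; [exact: Defs.GL_unit|rewrite AM].
move=> g; apply/seteqP; split; first exact: sub.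
move=> x Ox; exists (pact (rep_fun rho g^-1%g) x); first by apply: (sub g^-1%g);
  exists x.
by rewrite -pactM -rep_funM mulgV rep_fun1 pact1.
Qed.

End Projectivization.

(** * Degeneration to a nondegenerate trace form *)

Section NilIdeal.
Variables (R : realType) (n : nat) (W : {vspace 'M[R]_n.+1}).
Hypotheses (W1 : 1 \in W) (WM : forall X Y, X \in W -> Y \in W -> X * Y \in W).

(* A nonzero X in the radical of the trace form yields, by minimality of the rank,
   a square-zero ideal; p projects onto its image. *)
Lemma trace_radical_projector X : X \in W -> X != 0 ->
  (forall Y, Y \in W -> \tr (X * Y) = 0) ->
  exists Z p, [/\ Z \in W, Z != 0, p * p = p, p * Z = Z & Z * p = 0] /\
    forall Y, Y \in W -> p * Y * p = Y * p.
Proof.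
pose J Z := Z \in W /\ forall Y, Y \in W -> \tr (Z * Y) = 0.
move=> XW X0 XJ.
pose P d := `[< exists2 Z, J Z /\ Z != 0 & \rank Z = d >].
have [|d /asboolP[Z [[ZW ZJ] Z0] rZ] dmin] := @ex_minnP P.
  by exists (\rank X); apply/asboolP; exists X.
have {}dmin Y : J Y -> Y != 0 -> (\rank Z <= \rank Y)%N.
  by move=> JY Y0; rewrite rZ; apply: dmin; apply/asboolP; exists Y.
(* If [Z * Y * Z] is nonzero, minimality of the rank recovers [Z] from it by right multiplication,
   so [T] is not nilpotent. Its Fitting idempotent lies in the radical, so it is traceless, hence
   zero. *)
have ZYZ Y : Y \in W -> Z * Y * Z = 0.
  move=> YW; apply/eqP; apply: contraT => ZYZ0.
  pose T := Z * Y.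
  have TW : T \in W by apply: WM.
  have JT : J T.
    by split=> // V VW; rewrite -mulrA; apply: ZJ; exact: WM.
  have JTZ : J (T * Z).
    split; first exact: WM.
    by move=> V VW; rewrite -mulrA; case: JT => _; apply; exact: WM.
  have [Q ZQ] : exists Q, Z = T * Z * Q.
    have sub : ((T * Z)^T <= Z^T)%MS by rewrite /T -mulrA -mulmxE trmx_mul submxMl.
    have := mxrank_leqif_sup sub; rewrite !mxrank_tr => /leqifP.
    case: ifP => [/submxP[D DE] _|_]; last by rewrite ltnNge dmin.
    by exists D^T; apply: trmx_inj; rewrite -!mulmxE trmx_mul trmxK.
  have Tk k : exists Q', Z = T ^+ k * Z * Q'.
    elim: k => [|k [Q' ZQ']]; first by exists 1; rewrite expr0 mul1r mulr1.
    by exists (Q * Q'); rewrite {1}ZQ' {1}ZQ exprSr !mulrA.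
  have [q ee] : exists2 q, (let e := horner_mx T ('X * q) in e * e = e) &
      horner_mx T ('X * q) != 0.
    apply: fitting_idempotent => k; apply: contra_neq Z0 => Tk0.
    by have [Q' ->] := Tk k; rewrite Tk0 !mul0r.
  have : J (horner_mx T ('X * q)).
    apply: (horner_mx_mulX_mem (S := J)) => //.
    - move=> A B [AW AJ] [BW BJ]; split; first exact: rpredD.
      by move=> V VW; rewrite mulrDl mxtraceD AJ// BJ// addr0.
    - move=> c A [AW AJ]; split; first exact: rpredZ.
      by move=> V VW; rewrite -scalerAl mxtraceZ AJ// mulr0.
    - move=> A [AW AJ]; split; first exact: WM.
      by move=> V VW; rewrite -mulrA; case: JT => _; apply; exact: WM.
  move: (horner_mx _ _) ee => /= e ee [_ /(_ 1 W1)]; rewrite mulr1 => tre e0.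
  by rewrite (idempotent_trace_eq0 ee tre) eqxx in e0.
(* Transposition turns images into row spaces: [S] encodes the sum of the images of all [Y *m Z]
   with [Y] in [W], a subspace stable under [W] and killed by [Z]. *)
pose S := (\sum_(i < \dim W) <<((vbasis W)`_i *m Z)^T>>)%MS.
have subS Y : Y \in W -> ((Y *m Z)^T <= S)%MS.
  move=> YW; rewrite (coord_vbasis YW) mulmx_suml linear_sum summx_sub// => i _.
  rewrite -scalemxAl linearZ scalemx_sub// /S.
  by rewrite (submx_trans _ (sumsmx_sup i _ (submx_refl _)))// genmxE.
have [pi piS piSub] : exists2 pi : 'M[R]_n.+1,
    (forall m (A : 'M[R]_(m, n.+1)), (A <= S)%MS -> A *m pi = A) & (pi <= S)%MS.
  exists (pinvmx S *m S); last exact: submxMl.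
  by move=> m A AS; rewrite mulmxA mulmxKpV.
exists Z, pi^T; split; first split=> //.
- by rewrite -mulmxE -trmx_mul piS.
- apply: trmx_inj; rewrite -mulmxE trmx_mul trmxK piS//.
  by have := subS 1 W1; rewrite mul1mx.
- rewrite -mulmxE; apply: trmx_inj; rewrite trmx_mul trmxK trmx0.
  have SZ : S *m Z^T = 0.
    rewrite /S; apply/eqP; rewrite -submx0 sumsmxMr; apply/sumsmx_subP => i _.
    rewrite submx0 -[X in X == 0]mulmx1; apply/eqP.
    have : (<<((vbasis W)`_i *m Z)^T>> <= ((vbasis W)`_i *m Z)^T)%MS by rewrite genmxE.
    move=> /submxP[D ->]; rewrite mulmx1 -!mulmxA -trmx_mul.
    have bW : (vbasis W)`_i \in W by apply: vbasis_mem; apply: mem_nth;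
      rewrite size_tuple.
    by have := ZYZ _ bW; rewrite -!mulmxE -mulmxA => ->; rewrite trmx0 mulmx0.
  by have /submxP[D ->] := piSub; rewrite -mulmxA SZ mulmx0.
move=> Y YW; rewrite -!mulmxE; apply: trmx_inj; rewrite !trmx_mul trmxK.
rewrite mulmxA piS//.
have SY : (S *m Y^T <= S)%MS.
  rewrite /S sumsmxMr; apply/sumsmx_subP => i _.
  rewrite (eqmxMr _ (genmxE _)) -trmx_mul mulmxA; apply: subS.
  by apply: WM => //; apply: vbasis_mem; apply: mem_nth; rewrite size_tuple.
exact: submx_trans (submxMr _ piSub) SY.
Qed.

End NilIdeal.

Section Degeneration.
Variables (R : realType) (n : nat) (G : groupType).
Local Notation Hom := (HomPGL R n G).

Lemma lifts1 : lifts (1 : 'M[R]_n.+1) (1%g : PGL R n).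
Proof. by exists (GLone R n). Qed.

Lemma rep_of_lifts (r : G -> 'M[R]_n.+1) : (forall g, r g \in unitmx) ->
  (forall g h, exists2 c, c != 0 & r g *m r h = c *: r (g * h)%g) ->
  exists rho : Hom, forall g, lifts (r g) (rep_fun rho g).
Proof.
move=> ur rM.
have [f fP] : {f : G -> PGL R n & forall g, lifts (r g) (f g)}.
  by apply: (@choice _ _ (fun g p => lifts (r g) p)) => g; exact: lifts_pi.
have fM : {morph f : g h / (g * h)%g >-> (g * h)%g}.
  move=> g h; have [c c0 rgh] := rM g h.
  by apply: (lifts_inj (lifts_scale c0 (fP (g * h)%g))); rewrite -rgh; exact: lifts_mul.
have fH : (f : {ptws G -> PGL R n}) \in HomPGL R n G by apply/mem_set.
by exists (exist (fun f => f \in HomPGL R n G) f fH).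
Qed.

Lemma lifts_conj_orbit (rho sigma : Hom) (r : G -> 'M[R]_n.+1) P :
  P \in unitmx -> (forall g, lifts (r g) (rep_fun rho g)) ->
  (forall g, lifts (P *m r g *m invmx P) (rep_fun sigma g)) -> conj_orbit rho sigma.
Proof.
move=> uP lr ls; have [p lp] := lifts_pi uP.
exists p => g; apply: (lifts_inj (ls g)).
by apply: lifts_mul; [exact: lifts_mul|exact: lifts_inv].
Qed.

Lemma rep_lift_mul (rho : Hom) (r : G -> 'M[R]_n.+1) g h :
  (forall g, lifts (r g) (rep_fun rho g)) -> exists2 c, c != 0 & r g *m r h =
    c *: r (g * h)%g.
Proof.
move=> lr; apply: (lifts_proportional (p := rep_fun rho (g * h)%g)) => //.
by rewrite rep_funM; exact: lifts_mul.
Qed.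

Section BlockDiagonal.
Variables (rho : Hom) (r : G -> 'M[R]_n.+1) (p q : 'M[R]_n.+1).
Hypotheses (lr : forall g, lifts (r g) (rep_fun rho g)) (pp : p * p = p)
  (pDq : p + q = 1).
Hypothesis pr : forall g, p * r g * p = r g * p.

(** By [pr] the image of [p] is invariant under the lifts; on them [block_diag] gives the direct sum
    of the actions on this subspace and on the quotient by it. *)
Definition block_diag (X : 'M[R]_n.+1) : 'M[R]_n.+1 := p * X * p + q * X * q.

Let qE : q = 1 - p. Proof. by rewrite -pDq addrAC subrr add0r. Qed.
Let pq : p * q = 0. Proof. by rewrite qE mulrBr mulr1 pp subrr. Qed.
Let qp : q * p = 0. Proof. by rewrite qE mulrBl mul1r pp subrr. Qed.
Let qq : q * q = q. Proof. by rewrite {1}qE mulrBl mul1r pq subr0. Qed.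
Let qrp g : q * r g * p = 0.
Proof. by rewrite qE mulrBl mul1r mulrBl pr subrr. Qed.

Lemma block_diagM g h : block_diag (r g) * block_diag (r h) = block_diag (r g * r h).
Proof.
rewrite /block_diag mulrDl !mulrDr.
have -> : p * r g * p * (p * r h * p) =
  p * r g * p * r h * p by rewrite !mulrA -(mulrA _ p p) pp.
have -> : p * r g * p * (q * r h * q) =
  0 by rewrite !mulrA -(mulrA _ p q) pq mulr0 !mul0r.
have -> : q * r g * q * (p * r h * p) =
  0 by rewrite !mulrA -(mulrA _ q p) qp mulr0 !mul0r.
have -> : q * r g * q * (q * r h * q) =
  q * r g * q * r h * q by rewrite !mulrA -(mulrA _ q q) qq.
rewrite addr0 add0r; congr (_ + _).
  by rewrite -(mulrA (p * r g) p) -(mulrA (p * r g) (p * r h)) pr !mulrA.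
by rewrite {2}qE mulrBr mulr1 qrp subr0 !mulrA.
Qed.

Lemma block_diagZ c X : block_diag (c *: X) = c *: block_diag X.
Proof. by rewrite /block_diag -!scalerAr -!scalerAl scalerDr. Qed.

Lemma block_diag1 : block_diag 1 = 1.
Proof. by rewrite /block_diag !mulr1 pp qq pDq. Qed.

(* Conjugating by t p + (1 - p) multiplies the off-diagonal block by t. *)
Lemma block_diag_rep : exists2 sigma : Hom, closure (conj_orbit rho) sigma &
  forall g, lifts (block_diag (r g)) (rep_fun sigma g).
Proof.
have unitr g : block_diag (r g) \in unitmx.
  have [c c0 rg] := rep_lift_mul g g^-1%g lr.
  rewrite mulgV in rg.
  have [d d0 r1] : exists2 d, d != 0 & r 1%g = d *: 1.
    by apply: (lifts_proportional (p := 1%g)); [rewrite -(rep_fun1 rho)|exact: lifts1].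
  have := block_diagM g g^-1%g; rewrite [r g * _]rg r1 !block_diagZ block_diag1.
  rewrite scalerA => h; have /mulmx1_unit[] // : block_diag (r g) *m
    ((c * d)^-1 *: block_diag (r g^-1%g)) = 1%:M.
  by rewrite -scalemxAr mulmxE h scalerA mulVf ?scale1r// mulf_neq0.
have [sigma ls] : exists sigma : Hom, forall g,
  lifts (block_diag (r g)) (rep_fun sigma g).
  apply: rep_of_lifts => // g h; have [c c0 rgh] := rep_lift_mul g h lr.
  by exists c; rewrite // mulmxE block_diagM [r g * _]rgh block_diagZ.
exists sigma => //.
pose t k : R := harmonic k.
have t0 k : t k != 0 by rewrite gt_eqF// harmonic_gt0.
pose D k := t k *: p + q.
pose E k := (t k)^-1 *: p + q.
have DE k : D k *m E k = 1.
  rewrite mulmxE /D /E mulrDl !mulrDr -!scalerAl -!scalerAr pp pq qp qq !scaler0 addr0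
    add0r.
  by rewrite scalerA divff// scale1r.
have uD k : D k \in unitmx by have [] := mulmx1_unit (DE k).
have ED k : invmx (D k) = E k by rewrite -[LHS]mulmx1 -[1%:M](DE k) mulKmx.
have DrE k g : D k *m r g *m E k = block_diag (r g) + t k *: (p * r g * q).
  rewrite !mulmxE /D /E mulrDl !mulrDr !mulrDl -!scalerAl -!scalerAr qrp !scaler0.
  rewrite addr0 scalerA divff// scale1r /block_diag -addrA; congr (_ + _).
  by rewrite addrC.
have [f fP] : {f : nat -> Hom & forall k g,
  lifts (D k *m r g *m invmx (D k)) (rep_fun (f k) g)}.
  apply: (@choice _ _ (fun k (f : Hom) => forall g,
    lifts (D k *m r g *m invmx (D k)) (rep_fun f g))) => k.
  apply: rep_of_lifts => [g|g h].
    by rewrite !unitmx_mul uD unitmx_inv uD (lifts_unit (lr g)).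
  have [c c0 rgh] := rep_lift_mul g h lr; exists c => //.
  by rewrite !mulmxA mulmxKV// -(mulmxA _ (r g)) rgh -scalemxAr -scalemxAl.
have fs : f @ \oo --> sigma.
  apply: cvg_rep => g.
  apply: (@cvg_pi R n _ \oo _ (fun k => D k *m r g *m invmx (D k)) (block_diag (r g))) => //.
  have -> : (fun k => D k *m r g *m invmx (D k)) =
    (fun k => block_diag (r g) + t k *: (p * r g * q)).
    by apply/funext => k; rewrite ED DrE.
  rewrite -[X in _ --> X]addr0; apply: cvgD; first exact: cvg_cst.
  by rewrite -(scale0r (p * r g * q)); apply: cvgZ;
    [exact: cvg_harmonic|exact: cvg_cst].
apply: (closed_cvg _ (@closed_closure _ _) _ _ fs); apply: nearW => k.
by apply: subset_closure; exact: (lifts_conj_orbit (uD k) lr).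
Qed.

End BlockDiagonal.

(* Choose sigma equivalent to rho whose lifts span an algebra W of least dimension: the
   trace form on W is then nondegenerate, as otherwise a block-diagonal degeneration
   would kill an element of W. *)
Lemma positive_rep_equiv_properly_convex (rho : Hom) : positive_rep rho ->
  exists2 sigma : Hom, chi_equiv rho sigma & preserves_properly_convex R n G sigma.
Proof.
move=> Prho.
pose P d := `[< exists sigma : Hom, exists2 W : {vspace 'M[R]_n.+1},
  chi_equiv rho sigma /\ \dim W = d &
  forall g M, lifts M (rep_fun sigma g) -> M \in W >].
have [|d /asboolP[sigma [W [rs dW] lW]] dmin] := @ex_minnP P.
  exists (\dim {:'M[R]_n.+1}); apply/asboolP; exists rho, fullv.
    by split=> //; exact: chi_equiv_refl.
  by move=> *; exact: memvf.
exists sigma => //.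
have [r lr rPF] : positive_rep sigma by apply/(positive_rep_chi_equiv rs).
have lr' g : lifts (r g) (rep_fun sigma g) by case: (lr g).
have rW g : r g \in W by apply: lW (lr' g).
(* By minimality of [d], [W] is spanned by the lifts, so linear conditions on [W] need only be
   checked on the [r g]. *)
have Wind (W2 : {vspace 'M[R]_n.+1}) : (forall g, r g \in W2) -> (W <= W2)%VS.
  move=> rW2; apply/capv_idPl/eqP; rewrite eqEdim capvSl dW /=.
  apply: dmin; apply/asboolP; exists sigma, (W :&: W2)%VS => // g M lM.
  have [c _ ->] := lifts_proportional lM (lr' g).
  by rewrite rpredZ// memv_cap rW rW2.
have WM X Y : X \in W -> Y \in W -> X * Y \in W.
  have WrM h Z : Z \in W -> Z * r h \in W.
    pose f := linfun (mulmxr (r h) : 'M[R]_n.+1 -> 'M[R]_n.+1).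
    have : (W <= f @^-1: W)%VS.
      apply: Wind => g; rewrite -memv_preim lfunE /=.
      by have [c _ ->] := rep_lift_mul g h lr'; rewrite rpredZ.
    by move=> /subvP sub /sub; rewrite -memv_preim lfunE.
  move=> XW; pose f := linfun (mulmx X : 'M[R]_n.+1 -> 'M[R]_n.+1).
  have : (W <= f @^-1: W)%VS.
    by apply: Wind => g; rewrite -memv_preim lfunE /=; exact: WrM.
  by move=> /subvP sub /sub; rewrite -memv_preim lfunE.
have W1 : 1 \in W by apply: (lW 1%g); rewrite rep_fun1; exact: lifts1.
have Wnd X : X \in W -> (forall g, \tr (X * r g) = 0) -> X = 0.
  move=> XW Xr; apply/eqP; apply: contraT => X0.
  have XJ Y : Y \in W -> \tr (X * Y) = 0.
    pose f := linfun (mxtrace \o mulmx X : 'M[R]_n.+1 -> R^o).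
    have fE Z : f Z = \tr (X *m Z) by rewrite lfunE.
    have : (W <= lker f)%VS by apply: Wind => g; rewrite memv_ker fE mulmxE Xr.
    by move=> /subvP sub /sub; rewrite memv_ker fE => /eqP.
  have [Z [p [[ZW Z0 pp pZ Zp] pY]]] := trace_radical_projector W1 WM XW X0 XJ.
  pose q := 1 - p; have pDq : p + q = 1 by rewrite addrC subrK.
  have [tau st lt] := block_diag_rep lr' pp pDq (fun g => pY _ (rW g)).
  pose L := linfun ((mulmxr p \o mulmx p) \+ (mulmxr q \o mulmx q) : 'M[R]_n.+1 ->
    'M[R]_n.+1).
  have LE A : L A = block_diag p q A by rewrite lfunE.
  have ZL : Z \in (W :&: lker L)%VS.
    rewrite memv_cap ZW memv_ker LE /block_diag pZ Zp add0r.
    by rewrite /q mulrBl mul1r pZ subrr mul0r eqxx.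
  have : (d <= \dim (L @: W))%N.
    apply: dmin; apply/asboolP; exists tau, (L @: W)%VS.
      split=> //; apply: chi_equiv_trans rs _; apply/asboolP; apply: rst_step.
      by exists tau; split=> //; apply: subset_closure; exact: conj_orbit_refl.
    move=> g M lM; have [c _ ->] := lifts_proportional lM (lt g).
    by rewrite -LE rpredZ// memv_img.
  rewrite -dW -(limg_ker_dim L W) -[leqRHS]add0n leq_add2r leqn0 dimv_eq0 => /eqP WL.
  by move: ZL; rewrite WL memv0 (negbTE Z0).
pose K0 : set 'M[R]_n.+1 := range (eval r).
pose K := closure K0.
have K0W : K0 `<=` [set X | X \in W].
  move=> _ [w _ <-] /=; elim: w => [g|u IHu v IHv|u IHu v IHv|c u IHu] //=.
  - exact: rpredD.
  - exact: WM.
  - exact: rpredZ.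
have KW : K `<=` [set X | X \in W] by apply: closure_subset_closed => //;
  exact: vspace_closed.
have cK0 : cone K0.
  split.
  - by exists (Scale 0 (Letter R 1%g)) => //=; rewrite normr0 scale0r.
  - by move=> _ _ [u _ <-] [v _ <-]; exists (Sum u v).
  - by move=> c _ c0 [u _ <-]; exists (Scale c u) => //=; rewrite ger0_norm.
have cK : cone K by exact: closure_cone.
have Kcl : closed K by exact: closed_closure.
have K0M X Y : K0 X -> K0 Y -> K0 (X *m Y).
  by move=> [u _ <-] [v _ <-]; exists (Product u v).
have KM X Y : K X -> K Y -> K (X * Y).
  move=> KX KY.
  have KXY Z : K0 Z -> K (X *m Z).
    move=> K0Z; have cl : closed ((fun A => A *m Z) @^-1` K).
      apply: preimage_closed => // A _.
      by apply: (@cvg_mulmx _ _ (nbhs A)); [exact: cvg_id|exact: cvg_cst].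
    by apply: (closure_subset_closed cl) KX => A K0A; apply: subset_closure; exact: K0M.
  have := closure_mulmx KXY KY; by rewrite -(proj1 (closure_id K)).
have KPF X : K X -> PF X.
  by apply: (closure_subset_closed (@PF_closed R n.+1)) => _ [w _ <-]; exact: rPF.
(* A lift of the identity is a nonzero scalar [c], and [PF] forces [c] to be its own nonnegative
   root; so 1 is a positive multiple of that lift. *)
have K1 : K 1.
  have [c c0 r1] : exists2 c, c != 0 & r 1%g = c *: 1.
    by apply: (lifts_proportional (p := 1%g));
      [rewrite -(rep_fun1 sigma)|exact: lifts1].
  have [x [x0 + _]] := rPF (Letter R 1%g).
  rewrite /= r1 scalemx1 -raddfB/= det_scalar => /eqP; rewrite expf_eq0/= subr_eq0 =>
    /eqP xc.
  apply: subset_closure; exists (Scale c^-1 (Letter R 1%g)) => //=.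
  by rewrite r1 ger0_norm ?invr_ge0 -?xc// xc scalerA mulVf// scale1r.
have KL g : K (r g) by apply: subset_closure; exists (Letter R g).
have Knd X : K X -> (forall Y, K Y -> \tr (X * Y) = 0) -> X = 0.
  by move=> /KW XW XK; apply: Wnd => // g; exact: XK.
have sK := semiring_sharp cK KM KPF Knd.
have idK : ideal K K by split=> // X Y KX KY; split; exact: KM.
have [v vP] := separating_vector cK K1 KM KPF Knd idK.
have Kv X : K X -> X *m v = 0 -> X = 0.
  by move=> KX /(vP _ KX)/(_ 1 K1); rewrite mulr1.
have [C [Ccl cC sC [u ui] KC]] := invariant_cone Kcl cK K1 sK KM Kv.
apply: (preserved_cone_properly_convex Ccl cC sC ui) => g; exists (r g) => // x;
  exact: KC.
Qed.

End Degeneration.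

Theorem theorem3p2 (R : realType) (n : nat) (G : groupType)
  (hG : finitely_generated G) :
  closed ((@chi R n G) @` preserves_properly_convex R n G
          : set (character_variety R n G)).
Proof.
rewrite -openC.
(* In the quotient topology it is enough that the preimage is closed. It is the set of positive
   representations, which is a union of classes, each of them meeting
   [preserves_properly_convex]. *)
suff E : (\pi_(character_variety R n G) : HomPGL R n G -> _) @^-1`
    (~` ((@chi R n G) @` preserves_properly_convex R n G)) = ~` (@positive_rep R n G).
  by rewrite /open/= /quotient_open E openC; exact: positive_rep_closed.
rewrite preimage_setC; congr (~` _); apply/seteqP; split=> rho /=.
  move=> [sigma Csigma /eqmodP srho].
  exact/(positive_rep_chi_equiv srho)/properly_convex_positive.
move=> /positive_rep_equiv_properly_convex[sigma rs Csigma].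
by exists sigma => //; apply/esym/eqmodP.
Qed.
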